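(* Let $N\ge2$, $1\le r\le N-1$, $m\ge2$ an integer, $\alpha=\begin{pmatrix}\alpha_{11}&\alpha_{12}\\\alpha_{21}&\alpha_{22}\end{pmatrix}\in\mathbb{C}^{N\times N}$ (independent of $\epsilon$). Let $$\beta_{m-1}=\sum_{i\ge0}\begin{pmatrix}A_{m-1,i}&B_{m-1,i}\\C_{m-1,i}&D_{m-1,i}\end{pmatrix}\epsilon^i,\qquad \beta_m=\begin{pmatrix}0&0\\C_{m,0}&D_{m,0}\end{pmatrix}+\sum_{i\ge1}\begin{pmatrix}A_{m,i}&B_{m,i}\\C_{m,i}&D_{m,i}\end{pmatrix}\epsilon^i$$ with $\det\beta_m=O(\epsilon^r)$ as $\epsilon\to0$, and define $\beta_{n}$, $n\ge m+1$, by $\beta_{n+1}=n\beta_n^{-1}-\beta_{n-1}-\beta_n-\alpha$. For $n=m+1,m+2,m+3$ denote by $\begin{pmatrix}A_{n,0}&B_{n,0}\\C_{n,0}&D_{n,0}\end{pmatrix}$ the coefficient of $\epsilon^0$ in the Laurent expansion of $\beta_n$ (whenever it is defined), and set $$Z_1=D_{m+1,0}+D_{m,0}^{-1}C_{m,0}B_{m+1,0},\quad Z_2=D_{m+2,0}+D_{m,0}^{-1}C_{m,0}B_{m+2,0},\quad Z_3=D_{m+3,0}.$$ Then: (1) If $\det D_{m,0}\neq0$, then $\det\beta_{m+1}=O(\epsilon^{-r})$ as $\epsilon\to0$ if and only if $\det Z_1\neq0$. (2) If $\det D_{m,0}\ne0$ and $\det Z_1\ne0$, then $\det\beta_{m+2}=O(\epsilon^{-r})$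 if and only if $\det Z_2\ne0$. (3) If $\det D_{m,0}\ne0$, $\det Z_1\ne0$ and $\det Z_2\ne0$, then $\det\beta_{m+3}=O(\epsilon^{r})$ if and only if $\det Z_3\neq0$. (4) If $\det D_{m,0}\ne0$, $\det Z_1\ne0$, $\det Z_2\ne0$ and $\det Z_3\ne0$, then generically $\det\beta_{m+4}=O(1)$ as $\epsilon\to0$.
   Context: Blocks: upper-left $r\times r$, upper-right $r\times(N-r)$, lower-left $(N-r)\times r$, lower-right $(N-r)\times(N-r)$. Expansions are asymptotic (formal) expansions in $\epsilon$; inverses are computed in the ring of such Laurent expansions. A condition $\det X=O(\epsilon^{k})$ is understood in the sense of exact order: $\det X=c\,\epsilon^{k}+O(\epsilon^{k+1})$ with $c\ne0$. ''Generically'' means: for all values of the parameters (the coefficients of the initial data and $\alpha$) except possibly those lying on finitely many algebraic subvarieties of the parameter space. *)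

(* Defs.v *)
From HB Require Import structures.
From mathcomp Require Import all_boot all_order all_algebra.
From mathcomp Require Import complex Rstruct.
From mathcomp Require Import mpoly.
Set Implicit Arguments. Unset Strict Implicit. Unset Printing Implicit Defensive.
Import Order.TTheory GRing.Theory Num.Theory.
Local Open Scope ring_scope.

Notation C := (Rdefinitions.R[i]).

(* A formal Laurent series  sum_{k>=0} lcoef k * eps^(lval + k). *)
Record lser (T : Type) := LSer { lval : int; lcoef : nat -> T }.

Section LSeries.
Variable R : pzRingType.

Definition coefL (s : lser R) (k : int) : R :=
  if lval s <= k then lcoef s `|k - lval s|%N else 0.

Definition eqL (s t : lser R) : Prop := forall k : int, coefL s k = coefL t k.

Definition addL (s t : lser R) : lser R :=
  let v := Order.min (lval s) (lval t) in
  LSer v (fun k => coefL s (v + k%:Z) + coefL t (v + k%:Z)).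

Definition oppL (s : lser R) : lser R := LSer (lval s) (fun k => - lcoef s k).

Definition subL (s t : lser R) : lser R := addL s (oppL t).

Definition mulL (s t : lser R) : lser R :=
  LSer (lval s + lval t)
       (fun k => \sum_(i < k.+1) lcoef s i * lcoef t (k - i)).

Definition natmulL (s : lser R) (n : nat) : lser R :=
  LSer (lval s) (fun k => lcoef s k *+ n).

Definition constL (a : R) : lser R := LSer 0 (fun k => if k == 0%N then a else 0).

Definition powL (c : nat -> R) : lser R := LSer 0 c.

Definition invL (X Y : lser R) : Prop := eqL (mulL X Y) (constL 1).

(* "s = O(eps^k)" in the sense of exact order: s = c eps^k + O(eps^(k+1)), c <> 0 *)
Definition exact_ord (s : lser R) (k : int) : Prop :=
  coefL s k != 0 /\ forall j : int, j < k -> coefL s j = 0.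

End LSeries.

(* determinant of a matrix-valued Laurent series X = eps^v P(eps), P a matrix
   power series: det X = eps^(n v) det P(eps); the k-th coefficient of det P is
   the k-th coefficient of the polynomial determinant of the truncation of P
   at order k. *)
Definition detL (R : comNzRingType) (n : nat) (X : lser 'M[R]_n) : lser R :=
  LSer (n%:Z * lval X)
       (fun k => (\det (\matrix_(i, j) \poly_(l < k.+1) lcoef X l i j))`_k).

Definition beta_rec (N m : nat) (alpha : 'M[C]_N) (beta : nat -> lser 'M[C]_N) : Prop :=
  forall n : nat, (m <= n)%N -> forall Y : lser 'M[C]_N, invL (beta n) Y ->
    eqL (beta n.+1)
        (subL (subL (subL (natmulL Y n) (beta n.-1)) (beta n)) (constL alpha)).

Definition c0 (N : nat) (X : lser 'M[C]_N) : 'M[C]_N := coefL X 0.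

Definition Z1 (r s m : nat) (beta : nat -> lser 'M[C]_(r + s)) : 'M[C]_s :=
  drsubmx (c0 (beta m.+1))
  + invmx (drsubmx (c0 (beta m))) *m dlsubmx (c0 (beta m)) *m ursubmx (c0 (beta m.+1)).
Definition Z2 (r s m : nat) (beta : nat -> lser 'M[C]_(r + s)) : 'M[C]_s :=
  drsubmx (c0 (beta m.+2))
  + invmx (drsubmx (c0 (beta m))) *m dlsubmx (c0 (beta m)) *m ursubmx (c0 (beta m.+2)).
Definition Z3 (r s m : nat) (beta : nat -> lser 'M[C]_(r + s)) : 'M[C]_s :=
  drsubmx (c0 (beta m.+3)).

Definition standing (r s m : nat) (alpha : 'M[C]_(r + s))
    (P Q : nat -> 'M[C]_(r + s)) (beta : nat -> lser 'M[C]_(r + s)) : Prop :=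
  [/\ eqL (beta m.-1) (powL P), eqL (beta m) (powL Q),
      ulsubmx (Q 0%N) = 0 /\ ursubmx (Q 0%N) = 0,
      exact_ord (detL (beta m)) r%:Z & beta_rec m alpha beta].

(* Parameter space used to express genericity: the entries of alpha and the
   coefficients of order <= K of beta_{m-1} (false) and beta_m (true). *)
Definition ptype (N K : nat) : finType :=
  (('I_N * 'I_N) + ('I_K.+1 * bool * 'I_N * 'I_N))%type.

Definition pval (N K : nat) (alpha : 'M[C]_N) (P Q : nat -> 'M[C]_N)
    (x : ptype N K) : C :=
  match x with
  | inl (i, j) => alpha i j
  | inr (k, b, i, j) => (if b then Q else P) (nat_of_ord k) i j
  end.

Definition ppoint (N K : nat) (alpha : 'M[C]_N) (P Q : nat -> 'M[C]_N) :
    'I_#|{: ptype N K}| -> C :=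
  fun j => pval alpha P Q (enum_val j).

(* Main.v *)
From mathcomp Require Import perm.
Require Import Defs.
From Stdlib Require Import ClassicalEpsilon.
From HB Require Import structures.
From mathcomp Require Import all_boot all_order all_algebra.
From mathcomp Require Import complex Rstruct.
From mathcomp Require Import mpoly.
From mathcomp Require Import zify ring.
Import Order.TTheory GRing.Theory Num.Theory.
Local Open Scope ring_scope.

Set Implicit Arguments.
Unset Strict Implicit.
Unset Printing Implicit Defensive.

(* Put E = diag(eps I_r, I_s).  The singularity is carried by a single factor E:
     beta_m = E U,  beta_{m+1} = V E^-1,  beta_{m+2} = W E^-1,  beta_{m+3} = E T,
   where U, V, W, T are matrix power series given by
     V = m U^-1 - (beta_{m-1} + beta_m + alpha) E,
     W = (m+1) E V^-1 E - V - (beta_m + alpha) E,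
     T = (m+2) W^-1 - (m+1) V^-1 + U,
   each step being legitimate as long as the previous constant term is
   invertible.  Hence det beta_n has exact order r or -r if and only if the
   constant term of the corresponding factor is invertible.  With G = D^-1 C the
   first r columns of the constant terms are explicit: for some invertible p,
   V_0 (1,0)^t = (1,-G)^t p = - W_0 (1,0)^t, and T_0 (1,-G)^t is -(m+3) p^-1 on
   top of 0; so det V_0, det W_0, det T_0 are det Z_1, det Z_2, det Z_3 up to
   nonzero factors.  Finally
     beta_{m+4} = ((m+3) T^-1 - W) E^-1 - E T - alpha,
   and the first r columns of the constant term of (m+3) T^-1 - W cancel, so
   beta_{m+4} is regular.  Its constant term is a rational function of the
   coefficients of order at most 2, whose numerator is the polynomial sought; it
   does not vanish for beta_{m-1} = diag(I_r, 0), beta_m = E,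
   alpha = diag(0, (m-2) I_s). *)

(** * Laurent series up to [eqL] *)

Section LaurentSeries.
Variable R : pzRingType.
Implicit Types (s t u : lser R) (a b k : int).

Lemma eqL_sym s t : eqL s t -> eqL t s.
Proof. by move=> st k; rewrite st. Qed.

Lemma eqL_trans s t u : eqL s t -> eqL t u -> eqL s u.
Proof. by move=> st tu k; rewrite st. Qed.

Lemma coefL_lt s k : k < lval s -> coefL s k = 0.
Proof. by rewrite /coefL leNgt => ->. Qed.

Lemma coefL_lval s (n : nat) : coefL s (lval s + n%:Z) = lcoef s n.
Proof. by rewrite /coefL lerDl lez_nat /= addrAC subrr add0r. Qed.

Lemma coefL_powL (c : nat -> R) (n : nat) : coefL (powL c) n%:Z = c n.
Proof. by rewrite -[n%:Z]add0r (coefL_lval (powL c)). Qed.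

Lemma coefLD s t k : coefL (addL s t) k = coefL s k + coefL t k.
Proof.
rewrite {1}/coefL /=; case: ifPn => [le_k|]; first by congr (coefL _ _ + coefL _ _); lia.
by move=> lt_k; rewrite !coefL_lt ?addr0//; lia.
Qed.

Lemma coefLN s k : coefL (oppL s) k = - coefL s k.
Proof. by rewrite /coefL /=; case: ifP; rewrite ?oppr0. Qed.

Lemma coefLB s t k : coefL (subL s t) k = coefL s k - coefL t k.
Proof. by rewrite coefLD coefLN. Qed.

Lemma coefLMn s n k : coefL (natmulL s n) k = coefL s k *+ n.
Proof. by rewrite /coefL /=; case: ifP; rewrite ?mul0rn. Qed.

Lemma coefL_constL (c : R) k : coefL (constL c) k = if k == 0 then c else 0.
Proof.
rewrite /coefL /= subr0; case: k => [[|n]|n] //=.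
Qed.

Lemma subL_eq s s' t t' : eqL s s' -> eqL t t' -> eqL (subL s t) (subL s' t').
Proof. by move=> ss tt k; rewrite !coefLB ss tt. Qed.

(** Meant as the coefficient of order [a + b + n] of a product, with [a] and [b] any lower bounds
    for the supports of the two factors. *)
Definition conv (f g : int -> R) a b (n : nat) : R :=
  \sum_(i < n.+1) f (a + i%:Z) * g (b + (n - i)%N%:Z).

Lemma conv_shiftl (f g : int -> R) a b (d n : nat) :
  (forall j, j < a + d%:Z -> f j = 0) ->
  conv f g a b (d + n) = conv f g (a + d%:Z) b n.
Proof.
move=> f0; rewrite /conv -addnS big_split_ord /= big1 ?add0r => [|i _].
  by apply: eq_bigr => i _; congr (f _ * g _); lia.
by rewrite f0 ?mul0r//; have := ltn_ord i; lia.
Qed.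

Lemma conv_shiftr (f g : int -> R) a b (d n : nat) :
  (forall j, j < b + d%:Z -> g j = 0) ->
  conv f g a b (n + d) = conv f g a (b + d%:Z) n.
Proof.
move=> g0; rewrite /conv -addSn big_split_ord /= [X in _ + X]big1 ?addr0 => [|i _].
  by apply: eq_bigr => i _; congr (f _ * g _); have := ltn_ord i; lia.
by rewrite g0 ?mulr0//; have := ltn_ord i; lia.
Qed.

Lemma conv_eq0 (f g : int -> R) a b (d e n : nat) :
  (forall j, j < a + d%:Z -> f j = 0) -> (forall j, j < b + e%:Z -> g j = 0) ->
  (n < d + e)%N -> conv f g a b n = 0.
Proof.
move=> f0 g0 lt_n; rewrite /conv big1 // => i _; have ltin := ltn_ord i.
have [lt_id|le_di] := ltnP i d; first by rewrite f0 ?mul0r//; lia.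
by rewrite g0 ?mulr0//; lia.
Qed.

(* The window [a, b] need not be the one given by the formal valuations: this is
   what makes the product compatible with [eqL]. *)
Lemma coefLM s t a b k :
  (forall j, j < a -> coefL s j = 0) -> (forall j, j < b -> coefL t j = 0) ->
  coefL (mulL s t) k =
    if a + b <= k then conv (coefL s) (coefL t) a b `|(k - (a + b))%R|%N else 0.
Proof.
move=> s0 t0.
(* Both windows are compared with a common lower one, from which each is reached by nonnegative
   shifts. *)
pose a' : int := Order.min a (lval s); pose b' : int := Order.min b (lval t).
have [d Ed] : exists d : nat, a' + d%:Z = a by exists `|(a - a')%R|%N; lia.
have [e Ee] : exists e : nat, b' + e%:Z = b by exists `|(b - b')%R|%N; lia.
have [d' Ed'] : exists d : nat, a' + d%:Z = lval s
  by exists `|(lval s - a')%R|%N; lia.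
have [e' Ee'] : exists e : nat, b' + e%:Z = lval t
  by exists `|(lval t - b')%R|%N; lia.
have s0' j : j < a' + d'%:Z -> coefL s j = 0 by rewrite Ed'; apply: coefL_lt.
have t0' j : j < b' + e'%:Z -> coefL t j = 0 by rewrite Ee'; apply: coefL_lt.
rewrite -{1}Ed in s0; rewrite -{1}Ee in t0.
have -> : coefL (mulL s t) k =
    if a' + b' <= k then conv (coefL s) (coefL t) a' b' `|(k - (a' + b'))%R|%N else 0.
  rewrite {1}/coefL /= -Ed' -Ee'; case: (leP (a' + d'%:Z + _) k) => le_k.
    have [n En] : exists n : nat, k = a' + b' + (d' + (n + e'))%N%:Z.
      by exists `|(k - (a' + d'%:Z + (b' + e'%:Z)))%R|%N; lia.
    rewrite ifT; last by lia.
    have -> : `|(k - (a' + b'))%R|%N = (d' + (n + e'))%N by lia.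
    have -> : `|(k - (a' + d'%:Z + (b' + e'%:Z)))%R|%N = n by lia.
    rewrite conv_shiftl // conv_shiftr // Ed' Ee'.
    by apply: eq_bigr => i _; rewrite !coefL_lval.
  case: leP => // le_k'; rewrite (conv_eq0 (d := d') (e := e')) //; lia.
case: (leP (a + b) k) => le_k.
  have [n En] : exists n : nat, k = a + b + n%:Z by exists `|(k - (a + b))%R|%N; lia.
  rewrite ifT; last by lia.
  have -> : `|(k - (a' + b'))%R|%N = (d + (n + e))%N by lia.
  have -> : `|(k - (a + b))%R|%N = n by lia.
  by rewrite conv_shiftl // conv_shiftr // Ed Ee.
case: leP => // le_k'; rewrite (conv_eq0 (d := d) (e := e)) //; lia.
Qed.

Lemma mulL_eq s s' t t' : eqL s s' -> eqL t t' -> eqL (mulL s t) (mulL s' t').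
Proof.
move=> ss tt k.
have s0 j : j < lval s -> coefL s' j = 0 by rewrite -ss; apply: coefL_lt.
have t0 j : j < lval t -> coefL t' j = 0 by rewrite -tt; apply: coefL_lt.
rewrite (coefLM _ (@coefL_lt s) (@coefL_lt t)) (coefLM _ s0 t0).
by case: ifP => // _; apply: eq_bigr => i _; rewrite ss tt.
Qed.

Lemma coefLM_lead s t a b :
  (forall j, j < a -> coefL s j = 0) -> (forall j, j < b -> coefL t j = 0) ->
  coefL (mulL s t) (a + b) = coefL s a * coefL t b /\
  (forall j, j < a + b -> coefL (mulL s t) j = 0).
Proof.
move=> s0 t0; split=> [|j lt_j]; rewrite (coefLM _ s0 t0).
  by rewrite lexx subrr /= /conv big_ord1 !addr0.
by rewrite leNgt lt_j.
Qed.

Lemma mulLA s t u : eqL (mulL s (mulL t u)) (mulL (mulL s t) u).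
Proof.
move=> k; rewrite /coefL /= addrA; case: ifP => // _.
move: `|_|%N => n.
pose F (i l : nat) := lcoef s i * lcoef t (l - i) * lcoef u (n - l).
(* Both sides sum over index triples of total [n]; the substitution [l = i + j] turns one nested sum
   into the other. *)
transitivity (\sum_(l < n.+1) \sum_(i < n.+1 | (i <= l)%N) F i l); last first.
  apply: eq_bigr => l _; rewrite mulr_suml.
  by rewrite (big_ord_widen n.+1 (F^~ l)).
rewrite (exchange_big_dep xpredT) //=; apply: eq_bigr => i _.
rewrite mulr_sumr -[RHS](big_mkord (fun l => i <= l)%N (F i)).
rewrite -(big_nat_widenl i 0 n.+1 xpredT) //.
have := big_addn 0 n.+1 i xpredT (F i); rewrite add0n => ->.
rewrite subSn -1?ltnS // big_mkord; apply: eq_bigr => j _.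
by rewrite /F addnK mulrA addnC subnDA.
Qed.

(** The binomial [x eps^a + y eps^(a+1)], the shape shared by diag(eps I_r, I_s) and its inverse. *)
Definition two a (x y : R) : lser R :=
  LSer a (fun n => if n == 0%N then x else if n == 1%N then y else 0).

Lemma coefL_two a x y k :
  coefL (two a x y) k = if k == a then x else if k == a + 1 then y else 0.
Proof.
rewrite /coefL /=; case: leP => le_k; last by rewrite !ifF //; lia.
have -> : (`|(k - a)%R|%N == 0%N) = (k == a) by lia.
by have -> : (`|(k - a)%R|%N == 1%N) = (k == a + 1) by lia.
Qed.

Lemma coefL_twoM a x y s k :
  coefL (mulL (two a x y) s) k = x * coefL s (k - a) + y * coefL s (k - a - 1).
Proof.
(* Starting this low keeps both terms of the binomial inside the range of summation. *)
pose b : int := Order.min (lval s) (k - a - 2).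
have t0 j : j < b -> coefL s j = 0 by move=> lt_j; apply: coefL_lt; lia.
rewrite (coefLM _ (@coefL_lt (two a x y)) t0) /= ifT; last by lia.
have [n En] : exists n : nat, k - (a + b) = n.+2 by exists `|(k - (a + b) - 2)%R|%N; lia.
rewrite En /conv 2!big_ord_recl big1 ?addr0 /= => [|i _].
  rewrite !coefL_two /bump; congr (_ + _).
    rewrite ifT; last by lia.
    by congr (_ * coefL _ _) => /=; lia.
  rewrite ifF; last by lia.
  rewrite ifT; last by lia.
  by congr (_ * coefL _ _) => /=; lia.
rewrite coefL_two !ifF ?mul0r //; apply/negbTE; rewrite /bump; lia.
Qed.

Lemma coefL_Mtwo a x y s k :
  coefL (mulL s (two a x y)) k = coefL s (k - a) * x + coefL s (k - a - 1) * y.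
Proof.
pose b : int := Order.min (lval s) (k - a - 2).
have t0 j : j < b -> coefL s j = 0 by move=> lt_j; apply: coefL_lt; lia.
rewrite (coefLM _ t0 (@coefL_lt (two a x y))) /= ifT; last by lia.
have [n En] : exists n : nat, k - (b + a) = n.+2 by exists `|(k - (b + a) - 2)%R|%N; lia.
rewrite En /conv 2!big_ord_recr big1 ?add0r /= => [|i _].
  rewrite !coefL_two addrC; congr (_ + _).
    rewrite ifT; last by lia.
    by congr (coefL _ _ * _); lia.
  rewrite ifF; last by lia.
  rewrite ifT; last by lia.
  by rewrite add0r; congr (coefL _ _ * _); lia.
have lti := ltn_ord i; rewrite coefL_two !ifF ?mulr0 //; apply/negbTE; lia.
Qed.

End LaurentSeries.

(** * Determinants of matrix Laurent series *)

Section EqUpto.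
Variables (R : comNzRingType) (K : nat).

(** Congruence modulo ['X^(K+1)]. The truncation in [detL] varies with the coefficient, so
    truncations at different orders have to be compared. *)
Definition eq_upto (p q : {poly R}) := forall l, (l <= K)%N -> p`_l = q`_l.

Lemma eq_uptoD p p' q q' :
  eq_upto p p' -> eq_upto q q' -> eq_upto (p + q) (p' + q').
Proof. by move=> pp qq l le_l; rewrite !coefD pp ?qq. Qed.

Lemma eq_uptoM p p' q q' :
  eq_upto p p' -> eq_upto q q' -> eq_upto (p * q) (p' * q').
Proof.
move=> pp qq l le_l; rewrite !coefM; apply: eq_bigr => i _.
by have lti := ltn_ord i; rewrite pp ?qq //; lia.
Qed.

Lemma eq_upto_sum (I : Type) (s : seq I) (P : pred I) (p q : I -> {poly R}) :
  (forall i, eq_upto (p i) (q i)) ->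
  eq_upto (\sum_(i <- s | P i) p i) (\sum_(i <- s | P i) q i).
Proof. by move=> pq; elim/big_rec2: _ => // i x y _; apply: eq_uptoD. Qed.

Lemma eq_upto_det n (A B : 'M[{poly R}]_n) :
  (forall i j, eq_upto (A i j) (B i j)) -> eq_upto (\det A) (\det B).
Proof.
move=> AB; apply: eq_upto_sum => s; apply: eq_uptoM => //.
by elim/big_rec2: _ => // i x y _; apply: eq_uptoM.
Qed.

End EqUpto.

Section DeterminantSeries.
Variables (R : comNzRingType) (n : nat).
Implicit Types (X Y : lser 'M[R]_n).

Definition truncmx (K : nat) X : 'M[{poly R}]_n :=
  \matrix_(i, j) \poly_(l < K.+1) lcoef X l i j.

Lemma coef_truncmx K X i j l :
  (truncmx K X i j)`_l = if (l <= K)%N then lcoef X l i j else 0.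
Proof. by rewrite mxE coef_poly. Qed.

(** Higher terms of the entries cannot reach order [l]; hence one truncation serves all the
    coefficients that an identity involves. *)
Lemma lcoef_detL K X l : (l <= K)%N -> lcoef (detL X) l = (\det (truncmx K X))`_l.
Proof.
move=> le_l; apply: (eq_upto_det (K := l)) => // i j l' le_l'.
by rewrite !coef_truncmx le_l' (leq_trans le_l').
Qed.

Lemma truncmxM K X Y i j :
  eq_upto K (truncmx K (mulL X Y) i j) ((truncmx K X *m truncmx K Y) i j).
Proof.
move=> l le_l; rewrite coef_truncmx le_l mxE coef_sum summxE.
under eq_bigr => k _ do rewrite mxE.
rewrite exchange_big /=; apply: eq_bigr => h _; rewrite coefM.
by apply: eq_bigr => k _; have ltk := ltn_ord k; rewrite !coef_truncmx !ifT //; lia.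
Qed.

Lemma detLM X Y : eqL (detL (mulL X Y)) (mulL (detL X) (detL Y)).
Proof.
move=> k; rewrite /coefL [lval _]/= [lval (mulL _ _)]/= mulrDr; case: ifP => // _.
move: `|_|%N => l; rewrite (lcoef_detL (K := l)) //.
rewrite (eq_upto_det (@truncmxM l X Y)) // det_mulmx coefM.
by apply: eq_bigr => i _; have lti := ltn_ord i; rewrite -!lcoef_detL //; lia.
Qed.

(** Equal series may carry different formal valuations. A shift by [d] multiplies the truncated
    matrix by ['X^d], hence its determinant by ['X^(d n)], which is exactly the gap between the
    valuations of the two determinants. *)
Lemma detL_eq X Y : eqL X Y -> eqL (detL X) (detL Y).
Proof.
wlog le_XY : X Y / lval X <= lval Y => [IH XY|XY k].
  case: (leP (lval X) (lval Y)) => [le|/ltW le]; first exact: IH.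
  exact/eqL_sym/IH/eqL_sym.
have [d Ed] : exists d : nat, lval X + d%:Z = lval Y.
  by exists `|(lval Y - lval X)%R|%N; lia.
have lX l : lcoef X l = if (l < d)%N then 0 else lcoef Y (l - d)%N.
  rewrite -!coefL_lval XY -Ed; case: ltnP => le_l.
    by rewrite coefL_lt // -Ed ltrD2l ltz_nat.
  by rewrite -addrA -PoszD subnKC.
have tX K : truncmx (K + d) X = 'X^d *: truncmx K Y.
  apply/matrixP => i j; apply/polyP => l; rewrite coef_truncmx mxE coefXnM coef_truncmx lX.
  case: ltnP => [lt_ld|le_dl]; first by rewrite mxE if_same.
  by rewrite leq_subLR addnC.
rewrite /coefL [lval (detL X)]/= [lval (detL Y)]/= -Ed mulrDr -PoszM.
case: (leP _ k) => le_k; last by rewrite ifF //; apply/negbTE; lia.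
have [l El] : exists l : nat, k = n%:Z * lval X + l%:Z.
  by exists `|(k - n%:Z * lval X)%R|%N; lia.
have -> : `|(k - n%:Z * lval X)%R|%N = l by lia.
rewrite (lcoef_detL (K := l + d)) ?leq_addr // tX detZ -exprM coefXnM.
case: ltnP => lt_l; first by rewrite ifF //; apply/negbTE; lia.
rewrite ifT; last by lia.
have -> : `|(k - (n%:Z * lval X + (n * d)%N%:Z))%R|%N = (l - d * n)%N by lia.
by rewrite mulnC -lcoef_detL // leq_subr.
Qed.

Lemma coefL_detL_powL (c : nat -> 'M[R]_n) :
  coefL (detL (powL c)) 0 = \det (c 0%N) /\
  (forall j, j < 0 -> coefL (detL (powL c)) j = 0).
Proof.
have lv : lval (detL (powL c)) = 0 by rewrite /= mulr0.
split=> [|j lt_j]; last by rewrite coefL_lt ?lv.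
have := coefL_lval (detL (powL c)) 0; rewrite lv addr0 => ->.
rewrite (lcoef_detL (K := 0)) //.
have -> : truncmx 0 (powL c) = map_mx polyC (c 0%N).
  by apply/matrixP => i j; apply/polyP => l; rewrite coef_truncmx !mxE coefC; case: l.
by rewrite det_map_mx coefC.
Qed.

Lemma coefL_detL_two (v k : int) (x y : 'M[R]_n) :
  coefL (detL (two v x y)) k =
    if n%:Z * v <= k
    then (\det (map_mx polyC x + 'X *: map_mx polyC y))`_`|(k - n%:Z * v)%R|%N
    else 0.
Proof.
rewrite /coefL [lval _]/=; case: ifP => // _; move: `|_|%N => l.
(* Truncation at [l.+1], not at [l], keeps the second term even for [l = 0]. *)
rewrite (lcoef_detL (K := l.+1)) //.
suff -> : truncmx l.+1 (two v x y) = map_mx polyC x + 'X *: map_mx polyC y by [].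
apply/matrixP => i j; apply/polyP => h; rewrite coef_truncmx !mxE coefD coefC coefXM coefC.
by case: h => [|[|h]] /=; rewrite ?mxE ?addr0 ?add0r // if_same.
Qed.

End DeterminantSeries.

(** * Inverses *)

Section SeriesInverse.
Variables (R : comUnitRingType) (n : nat) (h : nat -> 'M[R]_n).

(** The list is carried along because each new coefficient, obtained by solving [h * inv = 1] at its
    order, needs all the previous ones. *)
Fixpoint inv_coefs (k : nat) : seq 'M[R]_n :=
  if k is l.+1 then
    rcons (inv_coefs l) (invmx (h 0%N) *
      ((l == 0%N)%:R - \sum_(i < l) h (l - i)%N * nth 0 (inv_coefs l) i))
  else [::].

Definition inv_coef k := nth 0 (inv_coefs k.+1) k.

Lemma size_inv_coefs k : size (inv_coefs k) = k.
Proof. by elim: k => //= k IHk; rewrite size_rcons IHk. Qed.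

Lemma nth_inv_coefs k i : (i < k)%N -> nth 0 (inv_coefs k) i = inv_coef i.
Proof.
elim: k => // k IHk; rewrite ltnS leq_eqVlt => /predU1P[->//|lt_ik].
by rewrite /= nth_rcons size_inv_coefs lt_ik IHk.
Qed.

Lemma inv_coefE k : inv_coef k =
  invmx (h 0%N) * ((k == 0%N)%:R - \sum_(i < k) h (k - i)%N * inv_coef i).
Proof.
rewrite /inv_coef /= nth_rcons size_inv_coefs ltnn eqxx.
by under eq_bigr => i _ do rewrite nth_inv_coefs //.
Qed.

Lemma inv_coef0 : inv_coef 0 = invmx (h 0%N).
Proof. by rewrite inv_coefE big_ord0 subr0 mulr1. Qed.

Lemma inv_coef1 : inv_coef 1 = - (invmx (h 0%N) * h 1%N * invmx (h 0%N)).
Proof. by rewrite inv_coefE big_ord1 sub0r inv_coef0 mulrN mulrA. Qed.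

Lemma invL_powL : h 0%N \in unitmx -> invL (powL h) (powL inv_coef).
Proof.
move=> h0 k; rewrite /coefL /= addr0; case: ifP => // _; move: `|_|%N => l.
(* After reversal the last term is [h 0 * inv_coef l], whose recursive formula cancels the rest of
   the sum. *)
rewrite (reindex_inj rev_ord_inj) /= big_ord_recr /= !subSS !subnn !subn0.
under eq_bigr => i _ do rewrite subSS (subKn (ltnW (ltn_ord i))).
rewrite [inv_coef l]inv_coefE mulrA -[h 0%N * _]/(h 0%N *m _) mulmxV // mul1r.
by rewrite addrC subrK; case: (l == 0%N).
Qed.

End SeriesInverse.

Section RightInverse.
Variables (F : fieldType) (n : nat).
Implicit Types X Y : lser 'M[F]_n.

Lemma invL_detL_neq0 X Y : invL X Y -> exists l, lcoef (detL X) l != 0.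
Proof.
move=> XY; have := detLM X Y 0; rewrite (detL_eq XY).
have [-> _] := coefL_detL_powL (fun k => if k == 0%N then 1%:M else 0 : 'M[F]_n).
rewrite det1 /coefL; case: ifP => _ E1; last by have := oner_neq0 F; rewrite E1 eqxx.
move: E1; move: `|_|%N => l E1.
have [X0|] := boolP [forall i : 'I_l.+1, lcoef (detL X) i == 0].
  have := oner_neq0 F; rewrite E1 [lcoef _ _]/= big1 ?eqxx // => i _.
  by rewrite [X in X * _](eqP (forallP X0 i)) mul0r.
by rewrite negb_forall => /existsP[i Xi]; exists i.
Qed.

(* If [X Z = 0] then [det X * Z = adj X * X Z = 0], and [det X] is a nonzero
   scalar series. *)
Lemma invL_uniq X Y Y' : invL X Y -> invL X Y' -> eqL Y Y'.
Proof.
move=> XY XY'; pose b : int := Order.min (lval Y) (lval Y').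
pose z k := coefL Y (b + k%:Z) - coefL Y' (b + k%:Z).
have Y0 j : j < b -> coefL Y j = 0.
  by move=> lt_j; apply: coefL_lt; rewrite (lt_le_trans lt_j) // ge_min lexx.
have Y'0 j : j < b -> coefL Y' j = 0.
  by move=> lt_j; apply: coefL_lt; rewrite (lt_le_trans lt_j) // ge_min lexx orbT.
suff z0 k : z k = 0.
  move=> k; case: (leP b k) => [le_bk|lt_kb]; last by rewrite Y0 ?Y'0.
  have [l El] : exists l : nat, k = b + l%:Z by exists `|(k - b)%R|%N; lia.
  by apply/eqP; rewrite El -subr_eq0 -/(z l) z0.
have Xz l : lcoef (mulL X (powL z)) l = 0.
  have := XY (lval X + b + l%:Z); rewrite -XY'.
  rewrite (coefLM _ (@coefL_lt _ X) Y0) (coefLM _ (@coefL_lt _ X) Y'0).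
  rewrite ifT ?lerDl // addrAC subrr add0r /= => /eqP.
  rewrite -subr_eq0 /conv -sumrB => /eqP Ez; rewrite -[RHS]Ez.
  by apply: eq_bigr => i _; rewrite -mulrBr coefL_lval.
(* [d] is the index of the first nonzero coefficient of [det X]; the vanishing of [z t] goes by
   strong induction on [t]. *)
have [d dX dmin] := ex_minnP (invL_detL_neq0 XY).
apply/matrixP => i j; rewrite [RHS]mxE; move: k; apply: ltn_ind => t IHt.
pose A := truncmx (d + t) X; pose B := truncmx (d + t) (powL z).
have AB0 : eq_upto (d + t) ((\adj A *m (A *m B)) i j) 0.
  move=> l le_l; rewrite mxE coef_sum coef0 big1 // => k _; rewrite coefM big1 // => e _.
  rewrite -(truncmxM X (powL z)) ?coef_truncmx ?Xz ?mxE ?if_same ?mulr0 //.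
  exact: leq_trans (leq_subr _ _) le_l.
(* At order [d + t] of [det X * z], indices below [d] vanish by minimality and those above by
   induction; what remains is [z t] times a nonzero scalar. *)
have := AB0 _ (leqnn _); rewrite mulmxA mul_adj_mx mul_scalar_mx mxE coef0 coefM.
have dlt : (d < (d + t).+1)%N by lia.
rewrite (bigD1 (Ordinal dlt)) //= big1 ?addr0 => [|e].
  rewrite -lcoef_detL ?leq_addr // addKn coef_truncmx leq_addl => /eqP.
  by rewrite mulf_eq0 (negbTE dX) => /eqP.
rewrite -val_eqE /= => ne_ed; have lte := ltn_ord e; rewrite -lcoef_detL //.
have [lt_ed|le_de] := ltnP e d.
  have [->|/dmin] := eqVneq (lcoef (detL X) e) 0; first by rewrite mul0r.
  by rewrite leqNgt lt_ed.
rewrite coef_truncmx ifT; last by lia.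
by rewrite -[lcoef (powL z) _]/(z _) IHt ?mulr0 //; lia.
Qed.

End RightInverse.

(** * Scaling by diag(eps I_r, I_s) *)

Section Blocks.
Variables (F : fieldType) (r s : nat).

(** [E0] and [E1] are complementary idempotents, with [E = E0 + eps E1] and
    [E^-1 = eps^-1 E1 + E0]. *)
Definition E0 : 'M[F]_(r + s) := block_mx 0 0 0 1%:M.
Definition E1 : 'M[F]_(r + s) := block_mx 1%:M 0 0 0.

(* [diag(eps I_r, I_s)] and its inverse. *)
Definition EL : lser 'M[F]_(r + s) := two 0 E0 E1.
Definition EiL : lser 'M[F]_(r + s) := two (- 1) E1 E0.

Lemma E00 : E0 * E0 = E0.
Proof. by rewrite -[LHS]/(E0 *m E0) mulmx_block !(mul0mx, mulmx0) mulmx1 !add0r. Qed.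

Lemma E11 : E1 * E1 = E1.
Proof. by rewrite -[LHS]/(E1 *m E1) mulmx_block !(mul0mx, mulmx0) mulmx1 !addr0. Qed.

Lemma E01 : E0 * E1 = 0.
Proof.
by rewrite -[LHS]/(E0 *m E1) mulmx_block !(mul0mx, mulmx0) !addr0 block_mx0.
Qed.

Lemma E10 : E1 * E0 = 0.
Proof.
by rewrite -[LHS]/(E1 *m E0) mulmx_block !(mul0mx, mulmx0) !addr0 block_mx0.
Qed.

Lemma addE01 : E0 + E1 = 1.
Proof. by rewrite add_block_mx !add0r addr0 -scalar_mx_block. Qed.

Lemma mulL1 (X : lser 'M[F]_(r + s)) : eqL (mulL X (constL 1)) X.
Proof.
have E : eqL (constL 1) (two 0 1 0 : lser 'M[F]_(r + s)).
  by move=> k; rewrite coefL_constL coefL_two add0r if_same.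
move=> k; rewrite (mulL_eq (fun j => erefl (coefL X j)) E).
by rewrite coefL_Mtwo mulr1 mulr0 addr0 subr0.
Qed.

Lemma invL_E : invL EL EiL.
Proof.
move=> k; rewrite coefL_twoM !coefL_two coefL_constL.
do ![case: eqP => ?]; try lia;
  by rewrite ?E00 ?E11 ?E01 ?E10 ?mulr0 ?addr0 ?add0r ?addE01.
Qed.

Lemma invL_Ei : invL EiL EL.
Proof.
move=> k; rewrite coefL_twoM !coefL_two coefL_constL.
do ![case: eqP => ?]; try lia;
  by rewrite ?E00 ?E11 ?E01 ?E10 ?mulr0 ?addr0 ?add0r ?[E1 + _]addrC ?addE01.
Qed.

Lemma invLM (X Y X' Y' : lser 'M[F]_(r + s)) :
  invL X X' -> invL Y Y' -> invL (mulL X Y) (mulL Y' X').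
Proof.
move=> XX YY; apply: eqL_trans (mulLA _ _ _) _; apply: eqL_trans XX.
apply: mulL_eq => //; apply: eqL_trans (eqL_sym (mulLA _ _ _)) _.
by apply: eqL_trans (mulL_eq _ YY) (mulL1 _).
Qed.

Lemma exact_ord_eq (x y : lser F) k : eqL x y -> exact_ord x k <-> exact_ord y k.
Proof.
by move=> xy; split=> -[c0 cj]; split=> [|j /cj]; rewrite ?xy // -xy.
Qed.

Lemma coefL_detL_EL j : coefL (detL EL) j = (j == r%:Z)%:R.
Proof.
rewrite coefL_detL_two mulr0 subr0.
have -> : map_mx polyC E0 + 'X *: map_mx polyC E1 = block_mx 'X%:M 0 0 1%:M.
  rewrite !map_block_mx scale_block_mx add_block_mx !map_mx0 !scaler0 !addr0 !add0r.
  by rewrite !map_mx1 scale_scalar_mx mulr1.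
rewrite det_ublock det_scalar det1 mulr1 coefXn.
by case: j => [j|j].
Qed.

Lemma coefL_detL_EiL j : coefL (detL EiL) j = (j == - r%:Z)%:R.
Proof.
rewrite coefL_detL_two.
have -> : map_mx polyC E1 + 'X *: map_mx polyC E0 = block_mx 1%:M 0 0 'X%:M.
  rewrite !map_block_mx scale_block_mx add_block_mx !map_mx0 !scaler0 !addr0 !add0r.
  by rewrite !map_mx1 scale_scalar_mx mulr1.
rewrite det_ublock det1 det_scalar mul1r coefXn.
case: ifP => le_j; last by rewrite [_ == _]negbTE //; lia.
by congr (_%:R); congr nat_of_bool; lia.
Qed.

(** As [det E = eps^r], the coefficient of order [r] of [det X] is [det (U 0)], and nothing lies
    below it. *)
Lemma exact_ord_ELM (X : lser 'M[F]_(r + s)) U :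
  eqL X (mulL EL (powL U)) -> exact_ord (detL X) r%:Z <-> \det (U 0%N) != 0.
Proof.
move=> XU; rewrite (exact_ord_eq _ (eqL_trans (detL_eq XU) (detLM _ _))).
have [U0 Uj] := coefL_detL_powL U.
have Ej j : j < r%:Z -> coefL (detL EL) j = 0.
  by rewrite coefL_detL_EL; case: eqP => // ->; rewrite ltxx.
have [] := coefLM_lead Ej Uj.
rewrite addr0 coefL_detL_EL eqxx mul1r U0 /exact_ord => -> z0.
by split=> [[]|].
Qed.

Lemma exact_ord_MEiL (X : lser 'M[F]_(r + s)) V :
  eqL X (mulL (powL V) EiL) -> exact_ord (detL X) (- r%:Z) <-> \det (V 0%N) != 0.
Proof.
move=> XV; rewrite (exact_ord_eq _ (eqL_trans (detL_eq XV) (detLM _ _))).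
have [V0 Vj] := coefL_detL_powL V.
have Ej j : j < - r%:Z -> coefL (detL EiL) j = 0.
  by rewrite coefL_detL_EiL; case: eqP => // ->; rewrite ltxx.
have [] := coefLM_lead Vj Ej.
rewrite add0r coefL_detL_EiL eqxx mulr1 V0 /exact_ord => -> z0.
by split=> [[]|].
Qed.

Lemma exact_ord_powL (X : lser 'M[F]_(r + s)) H :
  eqL X (powL H) -> exact_ord (detL X) 0 <-> \det (H 0%N) != 0.
Proof.
move=> XH; rewrite (exact_ord_eq _ (detL_eq XH)) /exact_ord.
by have [-> z0] := coefL_detL_powL H; split=> [[]|].
Qed.

(** Left multiplication by the unipotent matrix with block rows (1, 0) and (G, 1) clears the
    lower-left block and gives the lower-right one the form of [Z1] and [Z2]. *)
Lemma det_mul_lblock (X : 'M[F]_(r + s)) (p : 'M_r) (G : 'M_(s, r)) :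
  X *m col_mx 1%:M 0 = col_mx p (- (G *m p)) ->
  \det X = \det p * \det (drsubmx X + G *m ursubmx X).
Proof.
rewrite -{1}[X]submxK mul_block_col !mulmx1 !mulmx0 !addr0 => /eq_col_mx[Xp XG].
have <- : \det (block_mx 1%:M 0 G 1%:M *m X) = \det X.
  by rewrite det_mulmx det_lblock !det1 !mul1r.
rewrite -{1}[X]submxK mulmx_block !mul1mx !mul0mx !addr0 Xp XG.
by rewrite addrN det_ublock addrC.
Qed.

(** The column operation by [- G] makes the matrix block upper triangular and keeps its right-hand
    block column. *)
Lemma det_lblock_mul (X : 'M[F]_(r + s)) (q : 'M_r) (G : 'M_(s, r)) :
  X *m col_mx 1%:M (- G) = col_mx q 0 -> \det X = \det q * \det (drsubmx X).
Proof.
rewrite -{1}[X]submxK mul_block_col !mulmx1 !mulmxN => /eq_col_mx[Xq XG].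
have <- : \det (X *m block_mx 1%:M 0 (- G) 1%:M) = \det X.
  by rewrite det_mulmx det_lblock !det1 !mulr1.
rewrite -{1}[X]submxK mulmx_block !mulmx1 !mulmx0 !add0r !mulmxN Xq XG.
by rewrite det_ublock.
Qed.

End Blocks.

Lemma powLE (R : pzRingType) (x : lser R) :
  (forall j, j < 0 -> coefL x j = 0) -> eqL x (powL (fun k => coefL x k%:Z)).
Proof.
by move=> x0 [k|k]; [rewrite coefL_powL | rewrite x0].
Qed.

Lemma coefL_constL0 (R : pzRingType) (c : R) : coefL (constL c) 0 = c.
Proof. by rewrite coefL_constL. Qed.

Lemma invL_eq (R : pzRingType) (x x' y : lser R) : eqL x x' -> invL x' y -> invL x y.
Proof. by move=> xx; apply: eqL_trans; apply: mulL_eq. Qed.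

Section EpsilonScaling.
Variables (F : fieldType) (r s : nat).
Implicit Types x y : lser 'M[F]_(r + s).
Local Notation EL := (EL F r s).
Local Notation EiL := (EiL F r s).
Local Notation E0 := (E0 F r s).
Local Notation E1 := (E1 F r s).

Lemma coefL_ELM x k : coefL (mulL EL x) k = E0 * coefL x k + E1 * coefL x (k - 1).
Proof. by rewrite coefL_twoM subr0. Qed.

Lemma coefL_MEL x k : coefL (mulL x EL) k = coefL x k * E0 + coefL x (k - 1) * E1.
Proof. by rewrite coefL_Mtwo subr0. Qed.

Lemma coefL_MEiL x k : coefL (mulL x EiL) k = coefL x (k + 1) * E1 + coefL x k * E0.
Proof. by rewrite coefL_Mtwo opprK addrK. Qed.

Lemma coefL_MELEiL x k : coefL (mulL (mulL x EL) EiL) k = coefL x k.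
Proof.
rewrite -mulLA (mulL_eq (fun j => erefl (coefL x j)) (@invL_E F r s)).
exact: mulL1.
Qed.

Lemma coefL_BMEiL x y k :
  coefL (mulL (subL x y) EiL) k = coefL (mulL x EiL) k - coefL (mulL y EiL) k.
Proof. by rewrite !coefL_MEiL !coefLB !mulrBl opprD addrACA. Qed.

Lemma coefL_MnMEiL x n k :
  coefL (mulL (natmulL x n) EiL) k = coefL (mulL x EiL) k *+ n.
Proof. by rewrite !coefL_MEiL !coefLMn !mulrnAl mulrnDl. Qed.

End EpsilonScaling.

(** * The factors U, V, W, T *)

Section Orbit.
Variables (F : fieldType) (r s m : nat).
Local Notation M := 'M[F]_(r + s).
Local Notation EL := (EL F r s).
Local Notation EiL := (EiL F r s).
Local Notation E0 := (E0 F r s).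
Local Notation E1 := (E1 F r s).

Section Factors.
Variables (alpha : M) (P Q : nat -> M).

(** Coefficients of [E^-1 beta_m]; its term of order -1 would be [E1 * Q 0], zero when the upper
    blocks of [Q 0] vanish. *)
Definition Useq (k : nat) : M := E0 * Q k + E1 * Q k.+1.

(** Inverses enter through the total function [inv_coef]: the factors exist for all data, and
    describe the orbit once the preceding constant terms are invertible. *)
Definition Vser : lser M :=
  subL (natmulL (powL (inv_coef Useq)) m)
       (mulL (addL (addL (powL P) (powL Q)) (constL alpha)) EL).
Definition Vseq (k : nat) : M := coefL Vser k.

Definition Wser : lser M :=
  subL (subL (natmulL (mulL (mulL EL (powL (inv_coef Vseq))) EL) m.+1) (powL Vseq))
       (mulL (addL (powL Q) (constL alpha)) EL).
Definition Wseq (k : nat) : M := coefL Wser k.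

Definition Tseq (k : nat) : M :=
  inv_coef Wseq k *+ m.+2 - inv_coef Vseq k *+ m.+1 + Useq k.

Definition Hser : lser M :=
  subL (subL (mulL (powL (fun k => inv_coef Tseq k *+ m.+3 - Wseq k)) EiL)
             (mulL EL (powL Tseq))) (constL alpha).
Definition Hseq (k : nat) : M := coefL Hser k.

Lemma Vser_powL : eqL Vser (powL Vseq).
Proof.
apply: powLE => j lt_j; rewrite coefLB coefLMn coefL_MEL !coefLD !coefL_constL.
rewrite !(coefL_lt (s := powL _)) /= ?ifF ?(mul0rn, addr0, mul0r, subrr) //; lia.
Qed.

Lemma Wser_powL : eqL Wser (powL Wseq).
Proof.
apply: powLE => j lt_j; rewrite !coefLB coefLMn !coefL_MEL !coefL_ELM !coefLD !coefL_constL.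
rewrite !(coefL_lt (s := powL _)) /= ?ifF ?(mul0rn, addr0, mul0r, mulr0, subrr) //; lia.
Qed.

Lemma Vseq0 : Vseq 0 = invmx (Useq 0) *+ m - (P 0%N + Q 0%N + alpha) * E0.
Proof.
rewrite /Vseq coefLB coefLMn coefL_MEL !coefLD coefL_constL0 !coefL_powL.
rewrite !(@coefL_lt _ (powL _) (0 - 1)) // inv_coef0.
by rewrite !(mul0r, addr0).
Qed.

Lemma Vseq1 : Vseq 1 =
  inv_coef Useq 1 *+ m - ((P 1%N + Q 1%N) * E0 + (P 0%N + Q 0%N + alpha) * E1).
Proof.
rewrite /Vseq coefLB coefLMn coefL_MEL !coefLD !coefL_constL subrr !coefL_powL.
by rewrite addr0.
Qed.

Lemma Wseq0 : Wseq 0 =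
  (E0 * invmx (Vseq 0) * E0) *+ m.+1 - Vseq 0 - (Q 0%N + alpha) * E0.
Proof.
rewrite /Wseq !coefLB coefLMn !coefL_MEL !coefL_ELM !coefLD coefL_constL0 !coefL_powL.
rewrite !(@coefL_lt _ (powL _) (0 - 1)) // !(@coefL_lt _ (powL _) (0 - 1 - 1)) //.
by rewrite inv_coef0 !(mulr0, mul0r, addr0).
Qed.

Lemma Wseq1 : Wseq 1 =
  ((E0 * inv_coef Vseq 1 + E1 * invmx (Vseq 0)) * E0 + E0 * invmx (Vseq 0) * E1) *+ m.+1
  - Vseq 1 - (Q 1%N * E0 + (Q 0%N + alpha) * E1).
Proof.
rewrite /Wseq !coefLB coefLMn !coefL_MEL !coefL_ELM !coefLD !coefL_constL subrr.
rewrite !coefL_powL !(@coefL_lt _ (powL _) (0 - 1)) //.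
by rewrite inv_coef0 !(mulr0, mul0r, addr0).
Qed.

Lemma Tseq0 : Tseq 0 = invmx (Wseq 0) *+ m.+2 - invmx (Vseq 0) *+ m.+1 + Useq 0.
Proof. by rewrite /Tseq !inv_coef0. Qed.

(** [E^-1] lowers the order by one on the first [r] columns, so coefficients of order 1 of
    [(m+3) T^-1 - W] enter the constant term. *)
Lemma Hseq0 : Hseq 0 =
  (inv_coef Tseq 1 *+ m.+3 - Wseq 1) * E1 + (invmx (Tseq 0) *+ m.+3 - Wseq 0) * E0
  - E0 * Tseq 0 - alpha.
Proof.
rewrite /Hseq !coefLB coefL_MEiL coefL_ELM coefL_constL add0r.
rewrite !coefL_powL !(@coefL_lt _ (powL _) (0 - 1)) //.
by rewrite inv_coef0 !(mulr0, mul0r, addr0).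
Qed.

End Factors.
End Orbit.

Lemma coefL_ELM_powL_lin (F : fieldType) (r s n p : nat)
    (x y u : nat -> 'M[F]_(r + s)) k :
  coefL (mulL (EL F r s) (powL (fun j => x j *+ n - y j *+ p + u j))) k =
    coefL (mulL (EL F r s) (powL x)) k *+ n
    - coefL (mulL (EL F r s) (powL y)) k *+ p + coefL (mulL (EL F r s) (powL u)) k.
Proof.
have tE j : coefL (powL (fun j => x j *+ n - y j *+ p + u j)) j =
    coefL (powL x) j *+ n - coefL (powL y) j *+ p + coefL (powL u) j.
  case: j => j; first by rewrite !coefL_powL.
  by rewrite !(@coefL_lt _ (powL _)) // !mul0rn subrr addr0.
rewrite !coefL_ELM !tE !mulrDr !mulrN !mulrnAr !mulrnDl.
set x0 := E0 _ _ _ * coefL (powL x) _; set x1 := E1 _ _ _ * coefL (powL x) _.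
set y0 := E0 _ _ _ * coefL (powL y) _; set y1 := E1 _ _ _ * coefL (powL y) _.
by apply/matrixP => i j; rewrite !(mxE, mulmxnE); ring.
Qed.

Lemma coefL_ELM_Tseq (F : fieldType) (r s m : nat) (alpha : 'M[F]_(r + s))
    (P Q : nat -> 'M[F]_(r + s)) k :
  coefL (mulL (EL F r s) (powL (Tseq m alpha P Q))) k =
    coefL (mulL (EL F r s) (powL (inv_coef (Wseq m alpha P Q)))) k *+ m.+2
    - coefL (mulL (EL F r s) (powL (inv_coef (Vseq m alpha P Q)))) k *+ m.+1
    + coefL (mulL (EL F r s) (powL (Useq Q))) k.
Proof. exact: coefL_ELM_powL_lin. Qed.

(** Models the recurrence for [beta_(m+3)] after substitution of the one for [beta_(m+2)]: here [b]
    is [beta_(m+1)] and [a] is [alpha], and both cancel. *)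
Lemma telescope_sub (V : zmodType) (w v u b a : V) :
  w - b - (v - u - b - a) - a = w - v + u.
Proof.
by rewrite !opprD !opprK !addrA addrK [w - b - v]addrAC [w - v - b + u]addrAC subrK.
Qed.

Section BlockColumns.
Variables (F : fieldType) (r s : nat).
Local Notation M := 'M[F]_(r + s).
Local Notation E0 := (E0 F r s).
Local Notation E1 := (E1 F r s).
Local Notation e1 := (col_mx 1%:M 0 : 'M[F]_(r + s, r)).

Lemma E0M_block (X : M) : E0 * X = block_mx 0 0 (dlsubmx X) (drsubmx X).
Proof.
by rewrite -[LHS]/(E0 *m X) -{1}[X]submxK mulmx_block !(mul0mx, mul1mx, add0r).
Qed.

Lemma E1M_block (X : M) : E1 * X = block_mx (ulsubmx X) (ursubmx X) 0 0.
Proof.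
by rewrite -[LHS]/(E1 *m X) -{1}[X]submxK mulmx_block !(mul0mx, mul1mx, addr0).
Qed.

Lemma ME0_block (X : M) : X * E0 = block_mx 0 (ursubmx X) 0 (drsubmx X).
Proof.
by rewrite -[LHS]/(X *m E0) -{1}[X]submxK mulmx_block !(mulmx0, mulmx1, add0r).
Qed.

Lemma ME1_block (X : M) : X * E1 = block_mx (ulsubmx X) 0 (dlsubmx X) 0.
Proof.
by rewrite -[LHS]/(X *m E1) -{1}[X]submxK mulmx_block !(mulmx0, mulmx1, addr0).
Qed.

Lemma E0_e1 : E0 *m e1 = 0.
Proof. by rewrite mul_block_col !(mul0mx, mulmx0, addr0) col_mx0. Qed.

Lemma ME0_e1 (X : M) : X * E0 *m e1 = 0.
Proof. by rewrite -[X * E0]/(X *m E0) -mulmxA E0_e1 mulmx0. Qed.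

Lemma ME1_e1 (X : M) : X *m e1 = 0 -> X * E1 = 0.
Proof.
move=> X0; suff -> : E1 = e1 *m row_mx 1%:M 0.
  by rewrite -[LHS]/(X *m _) mulmxA X0 mul0mx.
by rewrite mul_col_row !(mul0mx, mulmx0, mulmx1).
Qed.

End BlockColumns.

(** At positive orders [E0 + E1 = 1] recovers [Q k]; at order 0 only [E0 * Q 0] appears, and this is
    [Q 0] because its upper blocks vanish. *)
Lemma eqL_ELM_Useq (F : fieldType) (r s : nat) (b : lser 'M[F]_(r + s))
    (Q : nat -> 'M[F]_(r + s)) :
  ulsubmx (Q 0%N) = 0 -> ursubmx (Q 0%N) = 0 -> eqL b (powL Q) ->
  eqL b (mulL (EL F r s) (powL (Useq Q))).
Proof.
move=> Q0ul Q0ur bQ.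
have E1Q0 : E1 F r s * Q 0%N = 0 by rewrite E1M_block Q0ul Q0ur block_mx0.
move=> k; rewrite bQ coefL_ELM; case: k => [[|k]|k].
- rewrite !coefL_powL (@coefL_lt _ (powL (Useq Q))) // mulr0 addr0 /Useq mulrDr !mulrA.
  by rewrite E00 E01 mul0r addr0 -[LHS]mul1r -addE01 mulrDl E1Q0 addr0.
- have -> : Posz k.+1 - 1 = k%:Z by lia.
  rewrite !coefL_powL /Useq !mulrDr !mulrA E00 E01 E10 E11 !mul0r addr0 add0r.
  by rewrite -mulrDl addE01 mul1r.
- by rewrite !(@coefL_lt _ (powL _)) ?mulr0 ?addr0 //; lia.
Qed.

Lemma Useq0_block (F : fieldType) (r s : nat) (Q : nat -> 'M[F]_(r + s)) :
  Useq Q 0 = block_mx (ulsubmx (Q 1%N)) (ursubmx (Q 1%N))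
                      (dlsubmx (Q 0%N)) (drsubmx (Q 0%N)).
Proof. by rewrite /Useq E0M_block E1M_block add_block_mx !(add0r, addr0). Qed.

(** Stated on the data [(alpha, P, Q)] alone, without the orbit, so as to serve as domain for the
    rational functions below. *)
Definition regular (F : fieldType) (r s m : nat)
    (d : 'M[F]_(r + s) * (nat -> 'M[F]_(r + s)) * (nat -> 'M[F]_(r + s))) :=
  [/\ Useq d.2 0%N \in unitmx, Vseq m d.1.1 d.1.2 d.2 0%N \in unitmx,
      Wseq m d.1.1 d.1.2 d.2 0%N \in unitmx & Tseq m d.1.1 d.1.2 d.2 0%N \in unitmx].

(** * The orbit through the singularity and the conditions on Z_1, Z_2, Z_3 *)

Section Confinement.
Variables (F : numFieldType) (r s m : nat).
Local Notation M := 'M[F]_(r + s).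
Local Notation EL := (EL F r s).
Local Notation EiL := (EiL F r s).
Local Notation E0 := (E0 F r s).
Local Notation E1 := (E1 F r s).
Variables (alpha : M) (P Q : nat -> M) (beta : nat -> lser M).
Hypothesis hm : (0 < m)%N.
Hypothesis betaP : eqL (beta m.-1) (powL P).
Hypothesis betaQ : eqL (beta m) (powL Q).
Hypothesis Q0ul : ulsubmx (Q 0%N) = 0.
Hypothesis Q0ur : ursubmx (Q 0%N) = 0.
Hypothesis beta_ord : exact_ord (detL (beta m)) r%:Z.
Hypothesis rec : forall n : nat, (m <= n)%N -> forall Y : lser M, invL (beta n) Y ->
  eqL (beta n.+1)
      (subL (subL (subL (natmulL Y n) (beta n.-1)) (beta n)) (constL alpha)).

Local Notation U := (Useq Q).
Local Notation V := (Vseq m alpha P Q).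
Local Notation W := (Wseq m alpha P Q).
Local Notation T := (Tseq m alpha P Q).
Local Notation H := (Hseq m alpha P Q).

(* Unification otherwise tries to identify these sequences by unfolding them. *)
Local Opaque Useq Vseq Wseq Tseq inv_coef.

Let beta_mE : eqL (beta m) (mulL EL (powL U)).
Proof. exact: eqL_ELM_Useq. Qed.

Lemma det_U0_neq0 : \det (U 0%N) != 0.
Proof. exact/(exact_ord_ELM beta_mE). Qed.

Lemma U0_unit : U 0%N \in unitmx.
Proof. by rewrite unitmxE unitfE det_U0_neq0. Qed.

(** Here [beta_m^-1 = U^-1 E^-1]; each remaining term [x] is written as [(x E) E^-1], so that [E^-1]
    factors out on the right. *)
Lemma beta_m1E : eqL (beta m.+1) (mulL (powL V) EiL).
Proof.
have inv : invL (beta m) (mulL (powL (inv_coef U)) EiL).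
  exact/(invL_eq beta_mE)/invLM/invL_powL/U0_unit/invL_E.
apply: (eqL_trans (rec (leqnn m) inv)) => k.
rewrite (mulL_eq (eqL_sym (@Vser_powL _ _ _ m alpha P Q)) (fun j => erefl (coefL EiL j))).
rewrite coefL_BMEiL coefL_MnMEiL coefL_MELEiL !coefLB coefLMn !coefLD betaP betaQ.
by rewrite !opprD !addrA.
Qed.

Lemma beta_m2E : V 0%N \in unitmx -> eqL (beta m.+2) (mulL (powL W) EiL).
Proof.
move=> V0.
have inv : invL (beta m.+1) (mulL EL (powL (inv_coef V))).
  exact/(invL_eq beta_m1E)/invLM/invL_Ei/invL_powL.
apply: (eqL_trans (rec (leqnSn m) inv)) => k.
rewrite (mulL_eq (eqL_sym (@Wser_powL _ _ _ m alpha P Q)) (fun j => erefl (coefL EiL j))).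
rewrite !coefL_BMEiL coefL_MnMEiL !coefL_MELEiL !coefLB coefLMn !coefLD betaQ beta_m1E.
by rewrite opprD addrA [X in X - _](addrAC).
Qed.

Lemma beta_m3E : V 0%N \in unitmx -> W 0%N \in unitmx ->
  eqL (beta m.+3) (mulL EL (powL T)).
Proof.
move=> V0 W0.
have invV : invL (beta m.+1) (mulL EL (powL (inv_coef V))).
  exact/(invL_eq beta_m1E)/invLM/invL_Ei/invL_powL.
have invW : invL (beta m.+2) (mulL EL (powL (inv_coef W))).
  exact/(invL_eq (beta_m2E V0))/invLM/invL_Ei/invL_powL.
apply: (eqL_trans (rec (leq_trans (leqnSn m) (leqnSn _)) invW)) => k.
have := rec (leqnSn m) invV k; rewrite !coefLB !coefLMn /= => ->.
have -> : coefL (beta m) k = coefL (mulL EL (powL U)) k by apply: beta_mE.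
rewrite coefL_ELM_Tseq.
exact: telescope_sub.
Qed.


Local Notation e1 := (col_mx 1%:M 0 : 'M[F]_(r + s, r)).
Local Notation G := (invmx (drsubmx (Q 0%N)) *m dlsubmx (Q 0%N)).
Local Notation wG := (col_mx 1%:M (- G) : 'M[F]_(r + s, r)).
Hypothesis D_unit : drsubmx (Q 0%N) \in unitmx.

(** [S] is the Schur complement of the lower-right block in [U 0]; [p] is the block for which [V 0]
    sends [e1] to [wG *m p], and [p'] is its inverse. *)
Let S := ulsubmx (U 0%N) - ursubmx (U 0%N) *m G.
Let p := m%:R *: invmx S.
Let p' := m%:R^-1 *: S.

Let U0_wG : U 0%N *m wG = e1 *m S.
Proof.
rewrite mul_col_mx mul1mx mul0mx -{1}[U 0%N]submxK mul_block_col !mulmx1 !mulmxN.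
congr col_mx.
rewrite Useq0_block.
by rewrite block_mxKdl block_mxKdr mulmxA mulmxV // mul1mx subrr.
Qed.

Let S_unit : S \in unitmx.
Proof.
rewrite unitmxE unitfE; have := det_U0_neq0.
have US : U 0%N *m wG = col_mx S 0 by rewrite U0_wG mul_col_mx mul1mx mul0mx.
by rewrite (det_lblock_mul US) mulf_eq0 negb_or => /andP[].
Qed.

Let m_neq0 : m%:R != 0 :> F. Proof. by rewrite pnatr_eq0 -lt0n. Qed.

Let pp' : p *m p' = 1%:M.
Proof. by rewrite -scalemxAl -scalemxAr scalerA divff // scale1r mulVmx. Qed.

Let p'p : p' *m p = 1%:M.
Proof. by rewrite -scalemxAl -scalemxAr scalerA mulVf // scale1r mulmxV. Qed.

Let det_p : \det p != 0.
Proof. by rewrite -unitfE -unitmxE; case: (mulmx1_unit pp'). Qed.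

Let det_p' : \det p' != 0.
Proof. by rewrite -unitfE -unitmxE; case: (mulmx1_unit pp'). Qed.

Let mulmx_invmx_l (X : M) (Y Z : 'M[F]_(r + s, r)) : X \in unitmx ->
  X *m Y = Z -> invmx X *m Z = Y.
Proof. by move=> X1 <-; rewrite mulmxA mulVmx // mul1mx. Qed.

(** A right factor [E0] kills [e1], so only [m U_0^-1 e1] survives, and [U_0 wG = e1 S] gives its
    value. *)
Let V0_e1 : V 0%N *m e1 = wG *m p.
Proof.
rewrite Vseq0 mulmxBl ME0_e1 subr0 -scaler_nat -scalemxAl -scalemxAr.
congr (_ *: _); apply: mulmx_invmx_l; first exact: U0_unit.
by rewrite mulmxA U0_wG -mulmxA mulmxV // mulmx1.
Qed.

(** Apart from [- V 0], every term of [W 0] ends with [E0] and kills [e1]; hence the sign opposite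
    to that of [V 0]. *)
Let W0_e1 : W 0%N *m e1 = - (wG *m p).
Proof.
rewrite Wseq0 2!mulmxBl -scaler_nat -scalemxAl !ME0_e1.
by rewrite scaler0 V0_e1 sub0r subr0.
Qed.

(** [X] is to be the constant coefficient of [beta m.+1], which is compared with [V 0] in its last
    [s] columns only, since [E^-1] alters the others. *)
Lemma det_V0_eq0 (X : M) : drsubmx X = drsubmx (V 0%N) -> ursubmx X = ursubmx (V 0%N) ->
  (\det (V 0%N) == 0) = (\det (drsubmx X + G *m ursubmx X) == 0).
Proof.
move=> -> ->; rewrite (det_mul_lblock (p := p) (G := G)) ?mulf_eq0 ?(negbTE det_p) //.
by rewrite V0_e1 mul_col_mx mul1mx mulNmx.
Qed.

Lemma det_W0_eq0 (X : M) : drsubmx X = drsubmx (W 0%N) -> ursubmx X = ursubmx (W 0%N) ->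
  (\det (W 0%N) == 0) = (\det (drsubmx X + G *m ursubmx X) == 0).
Proof.
move=> -> ->; rewrite (det_mul_lblock (p := - p) (G := G)).
  by rewrite -scaleN1r detZ !mulf_eq0 expf_eq0 oppr_eq0 oner_eq0 andbF (negbTE det_p).
by rewrite W0_e1 mul_col_mx mul1mx mulNmx mulmxN opp_col_mx.
Qed.

Section Confined.
Hypothesis V0_unit : V 0%N \in unitmx.
Hypothesis W0_unit : W 0%N \in unitmx.

(** On [wG] the three terms of [T 0] give [-(m+2)], [-(m+1)] and [m] times [e1 p']; the scalars add
    up to [-(m+3)]. *)
Let T0_wG : T 0%N *m wG = e1 *m (- m.+3%:R *: p').
Proof.
have V' : invmx (V 0%N) *m wG = e1 *m p'.
  by apply: (mulmx_invmx_l V0_unit); rewrite mulmxA V0_e1 -mulmxA pp' mulmx1.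
have W' : invmx (W 0%N) *m wG = - (e1 *m p').
  apply: (mulmx_invmx_l W0_unit).
  by rewrite mulmxN mulmxA W0_e1 mulNmx opprK -mulmxA pp' mulmx1.
have Sp' : S = m%:R *: p' by rewrite scalerA divff // scale1r.
have MnM n (A : M) : A *+ n *m wG = n%:R *: (A *m wG).
  by rewrite -scaler_nat scalemxAl.
rewrite Tseq0 mulmxDl mulmxBl (MnM _ (invmx (W _))) (MnM _ (invmx (V _))) V' W' U0_wG.
rewrite Sp' -!scalemxAr.
rewrite scalerN -scaleNr -scalerBl -scalerDl; congr (_ *: _).
by rewrite -!natr1; ring.
Qed.

Lemma det_T0_eq0 : (\det (T 0%N) == 0) = (\det (drsubmx (T 0%N)) == 0).
Proof.
rewrite (det_lblock_mul (q := - m.+3%:R *: p') (G := G)).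
  by rewrite detZ !mulf_eq0 expf_eq0 oppr_eq0 pnatr_eq0 andbF (negbTE det_p').
by rewrite T0_wG mul_col_mx mul1mx mul0mx.
Qed.

Lemma beta_m4E : T 0%N \in unitmx -> eqL (beta m.+4) (powL H).
Proof.
move=> T0; pose Mx k := inv_coef T k *+ m.+3 - W k.
(* The pole disappears here: [(m+3) T_0^-1 e1 = - wG p = W_0 e1], so the first [r] columns of [Mx 0]
   cancel. *)
have Mx0 : Mx 0%N * E1 = 0.
  apply: ME1_e1; rewrite /Mx inv_coef0 mulmxBl W0_e1 opprK -scaler_nat -scalemxAl.
  have -> : invmx (T 0%N) *m e1 = wG *m (- m.+3%:R^-1 *: p).
    apply: (mulmx_invmx_l T0); rewrite mulmxA T0_wG -mulmxA.
    suff -> : (- m.+3%:R *: p') *m (- m.+3%:R^-1 *: p) = 1%:M by rewrite mulmx1.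
    by rewrite -scalemxAl -scalemxAr p'p scalerA mulrNN divff ?pnatr_eq0 // scale1r.
  by rewrite -scalemxAr scalerA mulrN divff ?pnatr_eq0 // scaleN1r addNr.
have inv : invL (beta m.+3) (mulL (powL (inv_coef T)) EiL).
  exact/(invL_eq (beta_m3E V0_unit W0_unit))/invLM/invL_powL/T0/invL_E.
have MxE k : coefL (mulL (powL Mx) EiL) k =
    coefL (mulL (powL (inv_coef T)) EiL) k *+ m.+3 - coefL (mulL (powL W) EiL) k.
  rewrite -coefL_MnMEiL -coefL_BMEiL; apply: mulL_eq => // -[j|j].
    by rewrite coefLB coefLMn !coefL_powL.
  by rewrite coefLB coefLMn !(@coefL_lt _ (powL _)) // mul0rn subrr.
have HE : eqL (beta m.+4) (Hser m alpha P Q).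
  have lemn : (m <= m.+3)%N by lia.
  apply: (eqL_trans (rec lemn inv)) => k; rewrite /Hser -/Mx !coefLB coefLMn MxE.
  by rewrite (beta_m3E V0_unit W0_unit) (beta_m2E V0_unit).
apply: (eqL_trans HE); apply: powLE => j lt_j.
rewrite !coefLB coefL_constL ifF; last by apply/negbTE; lia.
rewrite coefL_MEiL coefL_ELM !(coefL_lt (s := powL T)) /=; try lia.
rewrite [coefL _ j]coefL_lt // mul0r mulr0 !addr0 mulr0 !subr0.
(* Among negative orders only -1 can receive a contribution, namely [Mx 0 * E1]. *)
rewrite addr0 subr0; have [->|ne_j] := eqVneq j (-1).
  by rewrite addNr coefL_powL -[RHS]Mx0.
by rewrite coefL_lt ?mul0r //=; lia.
Qed.

End Confined.

Local Notation Zmx b := (drsubmx (coefL b 0) +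
  invmx (drsubmx (coefL (beta m) 0)) *m dlsubmx (coefL (beta m) 0)
    *m ursubmx (coefL b 0)).

Let beta_m0 : coefL (beta m) 0 = Q 0%N.
Proof. by rewrite betaQ (coefL_powL Q 0). Qed.

(** [E^-1] shifts orders in the first [r] columns only. *)
Let submx_MEiL (b : lser M) (A : nat -> M) : eqL b (mulL (powL A) EiL) ->
  drsubmx (coefL b 0) = drsubmx (A 0%N) /\ ursubmx (coefL b 0) = ursubmx (A 0%N).
Proof.
move=> bA; rewrite bA coefL_MEiL (coefL_powL A 0) ME0_block ME1_block add_block_mx.
by rewrite block_mxKdr block_mxKur !add0r.
Qed.

Lemma det_Z1_eq0 : (\det (V 0%N) == 0) = (\det (Zmx (beta m.+1)) == 0).
Proof.
have [dr ur] := submx_MEiL beta_m1E.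
by rewrite beta_m0 (det_V0_eq0 dr ur).
Qed.

Lemma det_Z2_eq0 : V 0%N \in unitmx ->
  (\det (W 0%N) == 0) = (\det (Zmx (beta m.+2)) == 0).
Proof.
move=> V0; have [dr ur] := submx_MEiL (beta_m2E V0).
by rewrite beta_m0 (det_W0_eq0 dr ur).
Qed.

Lemma det_Z3_eq0 : V 0%N \in unitmx -> W 0%N \in unitmx ->
  (\det (T 0%N) == 0) = (\det (drsubmx (coefL (beta m.+3) 0)) == 0).
Proof.
move=> V0 W0; rewrite (det_T0_eq0 V0 W0) (beta_m3E V0 W0) coefL_ELM.
rewrite (coefL_powL T 0) (@coefL_lt _ (powL T) (0 - 1)) // mulr0 addr0.
by rewrite E0M_block block_mxKdr.
Qed.

Let unit_det (A : M) : (A \in unitmx) = (\det A != 0).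
Proof. by rewrite unitmxE unitfE. Qed.

(** The equivalences are chained, each relying on the invertibility of the earlier constant terms;
    that of [U 0] comes from the order of [det beta_m]. *)
Lemma regularE : regular m (alpha, P, Q) <->
  [/\ \det (Zmx (beta m.+1)) != 0, \det (Zmx (beta m.+2)) != 0
    & \det (drsubmx (coefL (beta m.+3) 0)) != 0].
Proof.
split=> [[_ V0 W0 T0]|[Z1 Z2 Z3]].
  rewrite -det_Z1_eq0 -(det_Z2_eq0 V0) -(det_Z3_eq0 V0 W0) -!unit_det.
  by split; [exact: V0|exact: W0|exact: T0].
have V0 : V 0%N \in unitmx by rewrite unit_det det_Z1_eq0.
have W0 : W 0%N \in unitmx by rewrite unit_det (det_Z2_eq0 V0).
split; [exact: U0_unit|exact: V0|exact: W0|].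
by rewrite unit_det (det_Z3_eq0 V0 W0).
Qed.

Lemma exact_ord_m1 :
  exact_ord (detL (beta m.+1)) (- r%:Z) <-> \det (Zmx (beta m.+1)) != 0.
Proof. by rewrite (exact_ord_MEiL beta_m1E) det_Z1_eq0. Qed.

Lemma exact_ord_m2 : \det (Zmx (beta m.+1)) != 0 ->
  exact_ord (detL (beta m.+2)) (- r%:Z) <-> \det (Zmx (beta m.+2)) != 0.
Proof.
rewrite -det_Z1_eq0 -unit_det => V0.
by rewrite (exact_ord_MEiL (beta_m2E V0)) (det_Z2_eq0 V0).
Qed.

Lemma exact_ord_m3 : \det (Zmx (beta m.+1)) != 0 -> \det (Zmx (beta m.+2)) != 0 ->
  exact_ord (detL (beta m.+3)) r%:Z <-> \det (drsubmx (coefL (beta m.+3) 0)) != 0.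
Proof.
rewrite -det_Z1_eq0 -unit_det => V0; rewrite -(det_Z2_eq0 V0) -unit_det => W0.
by rewrite (exact_ord_ELM (beta_m3E V0 W0)) (det_Z3_eq0 V0 W0).
Qed.

Lemma exact_ord_m4 : regular m (alpha, P, Q) ->
  exact_ord (detL (beta m.+4)) 0 <-> \det (H 0%N) != 0.
Proof. by case=> _ V0 W0 T0; apply/exact_ord_powL/(beta_m4E V0 W0 T0). Qed.

End Confinement.

(** * Rational dependence on the initial data *)

Section RationalFunctions.
Variables (F : fieldType) (D : Type) (dom : D -> Prop) (polyf : (D -> F) -> Prop).
Hypothesis polyf_cst : forall c, polyf (fun=> c).
Hypothesis polyfD : forall f g, polyf f -> polyf g -> polyf (fun d => f d + g d).
Hypothesis polyfM : forall f g, polyf f -> polyf g -> polyf (fun d => f d * g d).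

(** A quotient with cleared denominator. Nothing is asked outside [dom], where inverses may take
    default values. *)
Definition ratf (f : D -> F) := exists p q, [/\ polyf p, polyf q &
  forall d, dom d -> q d != 0 /\ f d * q d = p d].

Lemma ratf_eq f g : (forall d, dom d -> f d = g d) -> ratf f -> ratf g.
Proof.
move=> fg [p [q [Pp Pq fE]]]; exists p, q; split=> // d dd.
by rewrite -fg //; apply: fE.
Qed.

Lemma ratf_polyf f : polyf f -> ratf f.
Proof.
by move=> Pf; exists f, (fun=> 1); split=> // d _; rewrite oner_eq0 mulr1.
Qed.

Lemma ratf_cst c : ratf (fun=> c).
Proof. exact: ratf_polyf. Qed.

Lemma ratfD f g : ratf f -> ratf g -> ratf (fun d => f d + g d).
Proof.
move=> [p [q [Pp Pq fE]]] [p' [q' [Pp' Pq' gE]]].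
exists (fun d => p d * q' d + p' d * q d), (fun d => q d * q' d).
split=> [||d dd]; [by apply: polyfD; apply: polyfM|exact: polyfM|].
have [q0 <-] := fE d dd; have [q'0 <-] := gE d dd.
by rewrite mulf_neq0 //; split=> //; ring.
Qed.

Lemma ratfM f g : ratf f -> ratf g -> ratf (fun d => f d * g d).
Proof.
move=> [p [q [Pp Pq fE]]] [p' [q' [Pp' Pq' gE]]].
exists (fun d => p d * p' d), (fun d => q d * q' d).
split=> [||d dd]; [exact: polyfM|exact: polyfM|].
have [q0 <-] := fE d dd; have [q'0 <-] := gE d dd.
by rewrite mulf_neq0 //; split=> //; ring.
Qed.

Lemma ratfV f : (forall d, dom d -> f d != 0) -> ratf f -> ratf (fun d => (f d)^-1).
Proof.
move=> f0 [p [q [Pp Pq fE]]]; exists q, p; split=> // d dd.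
have [q0 <-] := fE d dd; split; first by rewrite mulf_neq0 ?f0.
by rewrite mulrA mulVf ?mul1r ?f0.
Qed.

Lemma ratf_sum (I : Type) (s : seq I) (P : pred I) (f : I -> D -> F) :
  (forall i, ratf (f i)) -> ratf (fun d => \sum_(i <- s | P i) f i d).
Proof.
move=> ff; elim: s => [|i s IHs].
  by apply: ratf_eq (ratf_cst 0) => d _; rewrite big_nil.
apply: (ratf_eq (f := fun d => (if P i then f i d else 0) + \sum_(i <- s | P i) f i d)).
  by move=> d _; rewrite big_cons; case: ifP; rewrite ?add0r.
by apply: ratfD => //; case: (P i); [apply: ff|apply: ratf_cst].
Qed.

Lemma ratf_prod (I : Type) (s : seq I) (P : pred I) (f : I -> D -> F) :
  (forall i, ratf (f i)) -> ratf (fun d => \prod_(i <- s | P i) f i d).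
Proof.
move=> ff; elim: s => [|i s IHs].
  by apply: ratf_eq (ratf_cst 1) => d _; rewrite big_nil.
apply: (ratf_eq (f := fun d => (if P i then f i d else 1) * \prod_(i <- s | P i) f i d)).
  by move=> d _; rewrite big_cons; case: ifP; rewrite ?mul1r.
by apply: ratfM => //; case: (P i); [apply: ff|apply: ratf_cst].
Qed.

Definition ratmx a b (A : D -> 'M[F]_(a, b)) := forall i j, ratf (fun d => A d i j).

Lemma ratmx_cst a b (A : 'M[F]_(a, b)) : ratmx (fun=> A).
Proof. by move=> i j; apply: ratf_cst. Qed.

Lemma ratmxD a b (A B : D -> 'M[F]_(a, b)) :
  ratmx A -> ratmx B -> ratmx (fun d => A d + B d).
Proof.
move=> rA rB i j; apply: ratf_eq (ratfD (rA i j) (rB i j)) => d _.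
by rewrite mxE.
Qed.

Lemma ratmxM a b c (A : D -> 'M[F]_(a, b)) (B : D -> 'M[F]_(b, c)) :
  ratmx A -> ratmx B -> ratmx (fun d => A d *m B d).
Proof.
move=> rA rB i j; pose f k d := A d i k * B d k j.
have rf k : ratf (f k) by apply: ratfM.
by apply: ratf_eq (ratf_sum (index_enum _) xpredT rf) => d _; rewrite mxE.
Qed.

Lemma ratmxZ a b c (A : D -> 'M[F]_(a, b)) : ratmx A -> ratmx (fun d => c *: A d).
Proof.
move=> rA i j; apply: ratf_eq (ratfM (ratf_cst c) (rA i j)) => d _.
by rewrite mxE.
Qed.

Lemma ratmxMn a b n (A : D -> 'M[F]_(a, b)) : ratmx A -> ratmx (fun d => A d *+ n).
Proof.
move=> rA i j; apply: ratf_eq (ratmxZ n%:R rA i j) => d _.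
by rewrite scaler_nat.
Qed.

Lemma ratmxN a b (A : D -> 'M[F]_(a, b)) : ratmx A -> ratmx (fun d => - A d).
Proof.
move=> rA i j; apply: ratf_eq (ratmxZ (-1) rA i j) => d _.
by rewrite scaleN1r.
Qed.

Lemma ratmxB a b (A B : D -> 'M[F]_(a, b)) :
  ratmx A -> ratmx B -> ratmx (fun d => A d - B d).
Proof. by move=> rA rB; apply: ratmxD => //; apply: ratmxN. Qed.

Lemma ratf_det n (A : D -> 'M[F]_n) : ratmx A -> ratf (fun d => \det (A d)).
Proof.
move=> rA; pose f (s : 'S_n) d := (-1) ^+ s * \prod_i A d i (s i).
have rf s : ratf (f s).
  by apply: ratfM; [apply: ratf_cst|apply: ratf_prod => i; apply: rA].
exact: ratf_sum rf.
Qed.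

(** Cramer's rule: cofactors divided by a determinant that does not vanish on [dom]. *)
Lemma ratmx_inv n (A : D -> 'M[F]_n) :
  (forall d, dom d -> A d \in unitmx) -> ratmx A -> ratmx (fun d => invmx (A d)).
Proof.
move=> A1 rA i j.
have rdet : ratf (fun d => (\det (A d))^-1).
  by apply: ratfV (ratf_det rA) => d /A1; rewrite unitmxE unitfE.
have radj : ratf (fun d => \adj (A d) i j).
  have rminor : ratmx (fun d => row' j (col' i (A d))).
    by move=> k l; apply: ratf_eq (rA (lift j k) (lift i l)) => d _; rewrite !mxE.
  apply: ratf_eq (ratfM (ratf_cst ((-1) ^+ (j + i))) (ratf_det rminor)) => d _.
  by rewrite mxE.
apply: ratf_eq (ratfM rdet radj) => d dd.
by rewrite /invmx (A1 d dd) [RHS]mxE.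
Qed.

End RationalFunctions.

(** * Rationality of the determinant of the limit *)

Section LimitRational.
Variables (F : fieldType) (r s m : nat).
Local Notation M := 'M[F]_(r + s).
Local Notation data := (M * (nat -> M) * (nat -> M))%type.
Local Notation U d := (@Useq F r s d.2).
Local Notation V d := (@Vseq F r s m d.1.1 d.1.2 d.2).
Local Notation W d := (@Wseq F r s m d.1.1 d.1.2 d.2).
Local Notation T d := (@Tseq F r s m d.1.1 d.1.2 d.2).
Local Notation H d := (@Hseq F r s m d.1.1 d.1.2 d.2).

Local Notation regular := (@regular F r s m).

Variable polyf : (data -> F) -> Prop.
Hypothesis polyf_cst : forall c, polyf (fun=> c).
Hypothesis polyfD : forall f g, polyf f -> polyf g -> polyf (fun d => f d + g d).
Hypothesis polyfM : forall f g, polyf f -> polyf g -> polyf (fun d => f d * g d).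
Hypothesis polyf_alpha : forall i j, polyf (fun d => d.1.1 i j).
Hypothesis polyf_P : forall k i j, polyf (fun d => d.1.2 k i j).
Hypothesis polyf_Q : forall k i j, polyf (fun d => d.2 k i j).

Let rat a b (A : data -> 'M[F]_(a, b)) := ratmx regular polyf A.

Let ratD a b (A B : data -> 'M[F]_(a, b)) : rat A -> rat B -> rat (fun d => A d + B d).
Proof. exact: ratmxD. Qed.
Let ratB a b (A B : data -> 'M[F]_(a, b)) : rat A -> rat B -> rat (fun d => A d - B d).
Proof. exact: ratmxB. Qed.
Let ratN a b (A : data -> 'M[F]_(a, b)) : rat A -> rat (fun d => - A d).
Proof. exact: ratmxN. Qed.
Let ratMn a b n (A : data -> 'M[F]_(a, b)) : rat A -> rat (fun d => A d *+ n).
Proof. exact: ratmxMn. Qed.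
Let ratM (A B : data -> M) : rat A -> rat B -> rat (fun d => A d * B d).
Proof. exact: ratmxM. Qed.
Let ratC (A : M) : rat (fun=> A).
Proof. exact: ratmx_cst. Qed.
Let rat_alpha : rat (fun d => d.1.1).
Proof. by move=> i j; apply: ratf_polyf. Qed.
Let ratP k : rat (fun d => d.1.2 k).
Proof. by move=> i j; apply: ratf_polyf. Qed.
Let ratQ k : rat (fun d => d.2 k).
Proof. by move=> i j; apply: ratf_polyf. Qed.
Let rat_eq a b (A B : data -> 'M[F]_(a, b)) : (forall d, A d = B d) -> rat B -> rat A.
Proof. by move=> AB rB i j; apply: ratf_eq (rB i j) => d _; rewrite AB. Qed.
Let rat_inv (A : data -> M) :
  (forall d, regular d -> A d \in unitmx) -> rat A -> rat (fun d => invmx (A d)).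
Proof. exact: ratmx_inv. Qed.
Let rat_inv1 (A : data -> nat -> M) : (forall d, regular d -> A d 0%N \in unitmx) ->
  rat (fun d => A d 0%N) -> rat (fun d => A d 1%N) -> rat (fun d => inv_coef (A d) 1).
Proof.
move=> A1 rA0 rA1; have rAV := rat_inv A1 rA0.
by apply: (rat_eq (fun d => inv_coef1 (A d))); apply/ratN/ratM/rAV/ratM.
Qed.

(** The factors are followed in turn, each inverse being legitimate on [regular]; orders 0 and 1 of
    [V], [W], [T] suffice for the constant term of [H]. *)
Lemma ratf_det_H : ratf regular polyf (fun d => \det (H d 0%N)).
Proof.
have rU k : rat (fun d => U d k) by apply: ratD; apply: ratM.
have Uu d : regular d -> U d 0%N \in unitmx by case.
have Vu d : regular d -> V d 0%N \in unitmx by case.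
have Wu d : regular d -> W d 0%N \in unitmx by case.
have Tu d : regular d -> T d 0%N \in unitmx by case.
have rUV := rat_inv Uu (rU 0%N).
have rU1 := @rat_inv1 (fun d => U d) Uu (rU 0%N) (rU 1%N).
have rV0 : rat (fun d => V d 0%N).
  apply: (rat_eq (fun d => Vseq0 m d.1.1 d.1.2 d.2)).
  by apply: ratB; [apply: ratMn|apply: ratM => //; apply: ratD => //; apply: ratD].
have rV1 : rat (fun d => V d 1%N).
  apply: (rat_eq (fun d => Vseq1 m d.1.1 d.1.2 d.2)).
  apply: ratB; [exact: ratMn|apply: ratD; apply: ratM => //].
    exact: ratD.
  by apply: ratD => //; apply: ratD.
have rVV := rat_inv Vu rV0.
have rVI := @rat_inv1 (fun d => V d) Vu rV0 rV1.
have rW0 : rat (fun d => W d 0%N).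
  apply: (rat_eq (fun d => Wseq0 m d.1.1 d.1.2 d.2)).
  apply: ratB; last by apply: ratM => //; apply: ratD.
  by apply: ratB => //; apply: ratMn; apply: ratM => //; apply: ratM.
have rW1 : rat (fun d => W d 1%N).
  apply: (rat_eq (fun d => Wseq1 m d.1.1 d.1.2 d.2)).
  apply: ratB; last first.
    by apply: ratD; apply: ratM => //; apply: ratD.
  apply: ratB => //; apply: ratMn; apply: ratD.
    by apply: ratM => //; apply: ratD; apply: ratM.
  by apply: ratM => //; apply: ratM.
have rWV := rat_inv Wu rW0.
have rWI := @rat_inv1 (fun d => W d) Wu rW0 rW1.
have rT0 : rat (fun d => T d 0%N).
  apply: (rat_eq (fun d => Tseq0 m d.1.1 d.1.2 d.2)).
  by apply: ratD => //; apply: ratB; apply: ratMn.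
have rT1 : rat (fun d => T d 1%N) by apply: ratD => //; apply: ratB; apply: ratMn.
have rTV := rat_inv Tu rT0.
have rTI := @rat_inv1 (fun d => T d) Tu rT0 rT1.
apply: ratf_det => //; apply: (rat_eq (fun d => Hseq0 m d.1.1 d.1.2 d.2)).
apply: ratB => //; apply: ratB; last exact: ratM.
by apply: ratD; apply: ratM => //; apply: ratB => //; apply: ratMn.
Qed.

End LimitRational.

(** * Admissible data with a regular orbit *)

Section OrbitExistence.
Variables (F : fieldType) (n m : nat) (alpha : 'M[F]_n) (P Q : nat -> 'M[F]_n).

(** A right inverse obtained by choice, arbitrary if none exists; the recurrence constrains the
    orbit only when there is one. *)
Definition rinvL (x : lser 'M[F]_n) : lser 'M[F]_n :=
  epsilon (inhabits (constL 0)) (invL x).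

Definition orbit_step (k : nat) (xy : lser 'M[F]_n * lser 'M[F]_n) :=
  (xy.2, subL (subL (subL (natmulL (rinvL xy.2) k) xy.1) xy.2) (constL alpha)).

(** The pair at [j] holds [beta_(m+j-1)] and [beta_(m+j)], which makes the recurrence first
    order. *)
Fixpoint orbit_pair (j : nat) :=
  if j is i.+1 then orbit_step (m + i) (orbit_pair i) else (powL P, powL Q).

Definition laurent_orbit (k : nat) : lser 'M[F]_n :=
  if (k < m)%N then powL P else (orbit_pair (k - m)).2.

(** The orbit uses a chosen inverse while the recurrence quantifies over all of them; uniqueness of
    right inverses closes the gap. *)
Lemma laurent_orbit_rec (k : nat) : (0 < m)%N -> (m <= k)%N ->
  forall Y, invL (laurent_orbit k) Y ->
  eqL (laurent_orbit k.+1)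
      (subL (subL (subL (natmulL Y k) (laurent_orbit k.-1)) (laurent_orbit k))
            (constL alpha)).
Proof.
move=> m0 le_mk; have [j ->] : exists j, k = (m + j)%N by exists (k - m)%N; lia.
have orbE i : laurent_orbit (m + i) = (orbit_pair i).2.
  by rewrite /laurent_orbit ifF; [congr (orbit_pair _).2; lia|lia].
have orbE1 : laurent_orbit (m + j).-1 = (orbit_pair j).1.
  case: j => [|i]; last by rewrite addnS orbE.
  by rewrite /laurent_orbit addn0 prednK // leqnn.
move=> Y invY; rewrite orbE1 -addnS orbE /= -orbE.
have inv' : invL (laurent_orbit (m + j)) (rinvL (laurent_orbit (m + j))).
  by apply: epsilon_spec; exists Y.
do 3!apply: subL_eq => //.
by move=> i; rewrite !coefLMn (invL_uniq inv' invY).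
Qed.

End OrbitExistence.

(** * An explicit block-diagonal orbit *)

Section Witness.
Variables (F : numFieldType) (r s m : nat).
Local Notation M := 'M[F]_(r + s).
Local Notation E0 := (E0 F r s).
Local Notation E1 := (E1 F r s).

(** diag(a I_r, b I_s). On such matrices the orbit reduces to two independent scalar
    computations. *)
Definition dg (a b : F) : M := a *: E1 + b *: E0.

Lemma dgM a b c d : dg a b * dg c d = dg (a * c) (b * d).
Proof.
have scM x y (A B : M) : (x *: A) * (y *: B) = (x * y) *: (A * B).
  by rewrite -[LHS]/((x *: A) *m (y *: B)) -scalemxAl -scalemxAr scalerA.
rewrite /dg mulrDl !mulrDr !scM E00 E01 E10 E11.
by rewrite !scaler0 addr0 add0r.
Qed.

Lemma dgD a b c d : dg a b + dg c d = dg (a + c) (b + d).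
Proof. by rewrite /dg !scalerDl addrACA. Qed.

Lemma dgN a b : - dg a b = dg (- a) (- b).
Proof. by rewrite /dg !scaleNr opprD. Qed.

Lemma dgMn a b k : dg a b *+ k = dg (a * k%:R) (b * k%:R).
Proof. by rewrite /dg mulrnDl -!scaler_nat !scalerA ![k%:R * _]mulrC. Qed.

Lemma dg0 : dg 0 0 = 0.
Proof. by rewrite /dg !scale0r addr0. Qed.

Lemma dg1 : dg 1 1 = 1.
Proof. by rewrite /dg !scale1r addrC addE01. Qed.

Lemma dgE0 : E0 = dg 0 1.
Proof. by rewrite /dg scale0r scale1r add0r. Qed.

Lemma dgE1 : E1 = dg 1 0.
Proof. by rewrite /dg scale0r scale1r addr0. Qed.

Lemma dgV a b : a != 0 -> b != 0 -> dg a b *m dg a^-1 b^-1 = 1%:M.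
Proof. by move=> a0 b0; rewrite -[LHS]/(dg a b * _) dgM !divff // dg1. Qed.

Lemma unitmx_dg a b : a != 0 -> b != 0 -> dg a b \in unitmx.
Proof. by move=> a0 b0; have [] := mulmx1_unit (dgV a0 b0). Qed.

Lemma invmx_dg a b : a != 0 -> b != 0 -> invmx (dg a b) = dg a^-1 b^-1.
Proof.
move=> a0 b0; rewrite -[LHS]mulmx1 -(dgV a0 b0) mulmxA mulVmx ?mul1mx //.
exact: unitmx_dg.
Qed.

(** For the other data chosen here, the upper entry of [H 0] is proportional to that of [wP 0],
    whence the value 1. *)
Definition wP (k : nat) : M := if k == 0%N then dg 1 0 else 0.
Definition wQ (k : nat) : M :=
  if k == 0%N then dg 0 1 else if k == 1%N then dg 1 0 else 0.
(** The entry [m - 2] gives [V 0] the lower entry [m - (1 + (m - 2)) = 1], and [W 0] again 1. *)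
Definition walpha : M := dg 0 (m%:R - 2).

Hypothesis hm : (1 < m)%N.

Local Notation U := (@Useq F r s wQ).
Local Notation V := (@Vseq F r s m walpha wP wQ).
Local Notation W := (@Wseq F r s m walpha wP wQ).
Local Notation T := (@Tseq F r s m walpha wP wQ).
Local Notation H := (@Hseq F r s m walpha wP wQ).

Let mu : F := m%:R.
Let mu0 : mu != 0. Proof. by rewrite pnatr_eq0 -lt0n ltnW. Qed.
Let mu3 : mu + 3 != 0. Proof. by rewrite -natrD pnatr_eq0 addnS. Qed.
Let two0 : 2 != 0 :> F. Proof. by rewrite pnatr_eq0. Qed.
Let muS k : (m + k)%:R = mu + k%:R. Proof. exact: natrD. Qed.
Let m1 : m.+1%:R = mu + 1. Proof. by rewrite -addn1 muS. Qed.
Let m2 : m.+2%:R = mu + 2. Proof. by rewrite -addn2 muS. Qed.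
Let m3 : m.+3%:R = mu + 3. Proof. by rewrite -addn3 muS. Qed.
Let dg_eq a b c d : a = c -> b = d -> dg a b = dg c d.
Proof. by move=> -> ->. Qed.

Let U0 : U 0%N = dg 1 1.
Proof. by rewrite /Useq /wQ /= dgE0 dgE1 !dgM dgD; apply: dg_eq; ring. Qed.
Let U1 : U 1%N = dg 0 0.
Proof. by rewrite /Useq /wQ /= dgE0 dgE1 -dg0 !dgM dgD; apply: dg_eq; ring. Qed.
Let iU0 : invmx (U 0%N) = dg 1 1.
Proof. by rewrite U0 invmx_dg ?oner_eq0 // invr1. Qed.
Let iU1 : inv_coef U 1 = dg 0 0.
Proof. by rewrite inv_coef1 iU0 U1 !dgM dgN; apply: dg_eq; ring. Qed.

Let V0 : V 0%N = dg mu 1.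
Proof.
rewrite Vseq0 iU0 /walpha /wP /wQ /= dgE0 !dgD !(dgM, dgMn) dgN dgD -/mu.
by apply: dg_eq; ring.
Qed.
Let V1 : V 1%N = dg (- 1) 0.
Proof.
rewrite Vseq1 iU1 /walpha /wP /wQ /= dgE0 dgE1 -dg0 !dgD !(dgM, dgMn) !dgD dgN dgD -/mu.
by apply: dg_eq; ring.
Qed.
Let iV0 : invmx (V 0%N) = dg mu^-1 1.
Proof. by rewrite V0 invmx_dg ?oner_eq0 // invr1. Qed.
Let iV1 : inv_coef V 1 = dg (mu ^- 2) 0.
Proof. by rewrite inv_coef1 iV0 V1 !dgM dgN; apply: dg_eq; field. Qed.

Let W0 : W 0%N = dg (- mu) 1.
Proof.
rewrite Wseq0 iV0 V0 /walpha /wQ /= dgE0 !dgD !(dgM, dgMn) !dgN !dgD m1 -/mu.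
by apply: dg_eq; ring.
Qed.
Let W1 : W 1%N = dg 1 0.
Proof.
rewrite Wseq1 iV0 iV1 V1 /walpha /wQ /= dgE0 dgE1.
rewrite !dgM !dgD !dgM !dgD dgMn !dgN !dgD m1 -/mu.
by apply: dg_eq; field.
Qed.
Let iW0 : invmx (W 0%N) = dg (- mu^-1) 1.
Proof. by rewrite W0 invmx_dg ?oppr_eq0 ?oner_eq0 // invr1 invrN. Qed.
Let iW1 : inv_coef W 1 = dg (- mu ^- 2) 0.
Proof. by rewrite inv_coef1 iW0 W1 !dgM dgN; apply: dg_eq; field. Qed.

Let T0 : T 0%N = dg (- ((mu + 3) / mu)) 2.
Proof.
by rewrite Tseq0 iW0 iV0 U0 !dgMn dgN !dgD m1 m2; apply: dg_eq; field.
Qed.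
Let T1 : T 1%N = dg (- ((2 * mu + 3) / mu ^+ 2)) 0.
Proof.
by rewrite /Tseq iW1 iV1 U1 !dgMn dgN !dgD m1 m2; apply: dg_eq; field.
Qed.
Let T00 : - ((mu + 3) / mu) != 0.
Proof. by rewrite oppr_eq0 mulf_neq0 // invr_eq0. Qed.
Let iT0 : invmx (T 0%N) = dg (- (mu / (mu + 3))) 2^-1.
Proof. by rewrite T0 invmx_dg // invrN invf_div. Qed.
Let iT1 : inv_coef T 1 = dg ((2 * mu + 3) / (mu + 3) ^+ 2) 0.
Proof.
rewrite inv_coef1 iT0 T1 !dgM dgN; apply: dg_eq; last by ring.
by field; rewrite mu0 mu3.
Qed.

Let H0 : H 0%N = dg (mu / (mu + 3)) ((1 - mu) / 2).
Proof.
rewrite Hseq0 iT0 iT1 W0 W1 T0 /walpha dgE0 dgE1 !dgMn !dgN !dgD !dgM !dgN !dgD m3 -/mu.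
by apply: dg_eq; field; rewrite ?mu3 ?mu0.
Qed.

Lemma witness_regular : regular m (walpha, wP, wQ).
Proof.
split; first by rewrite [Useq _ _]U0 unitmx_dg ?oner_eq0.
- by rewrite [Vseq _ _ _ _ _]V0 unitmx_dg ?oner_eq0.
- by rewrite [Wseq _ _ _ _ _]W0 unitmx_dg ?oppr_eq0 ?oner_eq0.
- by rewrite [Tseq _ _ _ _ _]T0 unitmx_dg.
Qed.

Lemma witness_H : \det (H 0%N) != 0.
Proof.
rewrite -unitfE -unitmxE H0 unitmx_dg ?mulf_neq0 ?invr_eq0 //.
(* The lower entry [(1 - m) / 2] of [H 0] is nonzero because [m >= 2]. *)
by rewrite subr_eq0 eq_sym /mu pnatr_eq1 gtn_eqF.
Qed.

Lemma witness_Q0 : [/\ ulsubmx (wQ 0%N) = 0, ursubmx (wQ 0%N) = 0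
  & drsubmx (wQ 0%N) = 1%:M].
Proof.
rewrite /wQ eqxx -dgE0; split.
- by rewrite block_mxKul.
- by rewrite block_mxKur.
- by rewrite block_mxKdr.
Qed.

Lemma witness_ord (b : lser M) : eqL b (powL wQ) -> exact_ord (detL b) r%:Z.
Proof.
have [Q0ul Q0ur _] := witness_Q0.
move=> bQ; apply/(exact_ord_ELM (eqL_ELM_Useq Q0ul Q0ur bQ)).
by rewrite U0 dg1 det1 oner_eq0.
Qed.

End Witness.

(** * Polynomials in the parameters *)

Section ParamPolynomials.
Variable N : nat.
Local Notation data := ('M[C]_N * (nat -> 'M[C]_N) * (nat -> 'M[C]_N))%type.

(** The bound [K] depends on [f]; sums and products first pass to a common bound. *)
Definition param_poly (f : data -> C) :=
  exists (K : nat) (p : {mpoly C[#|{: ptype N K}|]}),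
    forall d, p.@[@ppoint N K d.1.1 d.1.2 d.2] = f d.

Definition widen_ptype (K K' : nat) (le_K : (K <= K')%N) (x : ptype N K) : ptype N K' :=
  match x with
  | inl ij => inl ij
  | inr (k, b, i, j) => inr (widen_ord (le_K : (K < K'.+1)%N) k, b, i, j)
  end.

Lemma ppoint_enum_rank K alpha P Q (x : ptype N K) :
  @ppoint N K alpha P Q (enum_rank x) = @pval N K alpha P Q x.
Proof. by rewrite /ppoint enum_rankK. Qed.

(** Each variable is replaced by the variable of the same parameter in the larger space. *)
Lemma ppoint_widen K K' (le_K : (K <= K')%N) (p : {mpoly C[#|{: ptype N K}|]}) :
  exists p' : {mpoly C[#|{: ptype N K'}|]}, forall d : data,
    p'.@[@ppoint N K' d.1.1 d.1.2 d.2] = p.@[@ppoint N K d.1.1 d.1.2 d.2].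
Proof.
exists (comp_mpoly [tuple 'X_(enum_rank (widen_ptype le_K (enum_val j))) | j < _] p) => d.
rewrite comp_mpoly_meval; apply: meval_eq => j.
rewrite tnth_mktuple mevalXU ppoint_enum_rank /ppoint.
by case: (enum_val j) => [[i l]|[[[k b] i] l]].
Qed.

Lemma param_poly_cst c : param_poly (fun=> c).
Proof. by exists 0%N, c%:MP => d; rewrite mevalC. Qed.

Lemma param_poly_common f g : param_poly f -> param_poly g ->
  exists (K : nat) (p q : {mpoly C[#|{: ptype N K}|]}), forall d,
    p.@[@ppoint N K d.1.1 d.1.2 d.2] = f d /\ q.@[@ppoint N K d.1.1 d.1.2 d.2] = g d.
Proof.
move=> [K [p pf]] [K' [q qg]]; exists (maxn K K').
have [p' p'E] := ppoint_widen (leq_maxl K K') p.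
have [q' q'E] := ppoint_widen (leq_maxr K K') q.
by exists p', q' => d; rewrite p'E q'E.
Qed.

Lemma param_polyD f g :
  param_poly f -> param_poly g -> param_poly (fun d => f d + g d).
Proof.
move=> pf pg; have [K [p [q pq]]] := param_poly_common pf pg.
by exists K, (p + q) => d; have [<- <-] := pq d; rewrite mevalD.
Qed.

Lemma param_polyM f g :
  param_poly f -> param_poly g -> param_poly (fun d => f d * g d).
Proof.
move=> pf pg; have [K [p [q pq]]] := param_poly_common pf pg.
by exists K, (p * q) => d; have [<- <-] := pq d; rewrite mevalM.
Qed.

Lemma param_poly_pval K (x : ptype N K) :
  param_poly (fun d => @pval N K d.1.1 d.1.2 d.2 x).
Proof.
by exists K, 'X_(enum_rank x) => d; rewrite mevalXU ppoint_enum_rank.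
Qed.

Lemma param_poly_alpha i j : param_poly (fun d => d.1.1 i j).
Proof. exact: (param_poly_pval (K := 0) (inl (i, j))). Qed.

Lemma param_poly_P k i j : param_poly (fun d => d.1.2 k i j).
Proof. exact: (param_poly_pval (inr (@ord_max k, false, i, j))). Qed.

Lemma param_poly_Q k i j : param_poly (fun d => d.2 k i j).
Proof. exact: (param_poly_pval (inr (@ord_max k, true, i, j))). Qed.

End ParamPolynomials.

Lemma ratf_det_Hseq (r s m : nat) :
  ratf (@regular C r s m) (@param_poly (r + s))
    (fun d => \det (Hseq m d.1.1 d.1.2 d.2 0%N)).
Proof.
apply: ratf_det_H.
- exact: param_poly_cst.
- exact: param_polyD.
- exact: param_polyM.
- exact: param_poly_alpha.
- exact: param_poly_P.
- exact: param_poly_Q.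
Qed.

(* N = r + s with r = size of the upper-left block, s = N - r. *)
Theorem theorem2 (r s m : nat) (hr : (1 <= r)%N) (hs : (1 <= s)%N) (hm : (2 <= m)%N) :
  (forall (alpha : 'M[C]_(r + s)) (P Q : nat -> 'M[C]_(r + s))
          (beta : nat -> lser 'M[C]_(r + s)),
     standing m alpha P Q beta ->
     (* (1) *)
     (\det (drsubmx (c0 (beta m))) != 0 ->
        (exact_ord (detL (beta m.+1)) (- r%:Z) <-> \det (Z1 m beta) != 0)) /\
     (* (2) *)
     (\det (drsubmx (c0 (beta m))) != 0 -> \det (Z1 m beta) != 0 ->
        (exact_ord (detL (beta m.+2)) (- r%:Z) <-> \det (Z2 m beta) != 0)) /\
     (* (3) *)
     (\det (drsubmx (c0 (beta m))) != 0 -> \det (Z1 m beta) != 0 ->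
      \det (Z2 m beta) != 0 ->
        (exact_ord (detL (beta m.+3)) r%:Z <-> \det (Z3 m beta) != 0))) /\
  (* (4) generically: outside the zero set of a polynomial p in finitely many
     of the parameters, p not vanishing identically on the admissible data *)
  (exists (K : nat) (p : {mpoly C[#|{: ptype (r + s) K}|]}),
     (exists (alpha : 'M[C]_(r + s)) (P Q : nat -> 'M[C]_(r + s))
             (beta : nat -> lser 'M[C]_(r + s)),
        [/\ standing m alpha P Q beta,
            \det (drsubmx (c0 (beta m))) != 0 /\ \det (Z1 m beta) != 0,
            \det (Z2 m beta) != 0, \det (Z3 m beta) != 0 &
            p.@[@ppoint (r + s) K alpha P Q] != 0]) /\
     (forall (alpha : 'M[C]_(r + s)) (P Q : nat -> 'M[C]_(r + s))
             (beta : nat -> lser 'M[C]_(r + s)),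
        standing m alpha P Q beta ->
        \det (drsubmx (c0 (beta m))) != 0 -> \det (Z1 m beta) != 0 ->
        \det (Z2 m beta) != 0 -> \det (Z3 m beta) != 0 ->
        p.@[@ppoint (r + s) K alpha P Q] != 0 ->
        exact_ord (detL (beta m.+4)) 0)).
Proof.
have m0 : (0 < m)%N := ltnW hm.
have D_unit (Q : nat -> 'M[C]_(r + s)) (b : lser 'M[C]_(r + s)) :
    eqL b (powL Q) -> \det (drsubmx (c0 b)) != 0 -> drsubmx (Q 0%N) \in unitmx.
  by move=> bQ; rewrite /c0 bQ (coefL_powL Q 0) unitmxE unitfE.
split.
  move=> alpha P Q beta [bP bQ [Q0ul Q0ur] bord brec].
  split; [|split] => /(D_unit _ _ bQ) D1.
  - exact: (exact_ord_m1 m0 bP bQ Q0ul Q0ur bord brec D1).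
  - exact: (exact_ord_m2 m0 bP bQ Q0ul Q0ur bord brec D1).
  - exact: (exact_ord_m3 m0 bP bQ Q0ul Q0ur bord brec D1).
(* On regular data [det (H 0) * g = f] with [g] nonzero; the numerator [f] provides the polynomial
   [p]. *)
have [f [g [[K [p pE]] Pg fg]]] := ratf_det_Hseq r s m.
exists K, p; split.
  pose a := @walpha C r s m; pose P := @wP C r s; pose Q := @wQ C r s.
  have [Q0ul Q0ur Q0dr] := witness_Q0 C r s.
  have reg : regular m (a, P, Q) := witness_regular C r s hm.
  pose b := laurent_orbit m a P Q.
  have bP : eqL (b m.-1) (powL P) by rewrite /b /laurent_orbit prednK // leqnn.
  have bQ : eqL (b m) (powL Q) by rewrite /b /laurent_orbit ltnn subnn.
  have bord : exact_ord (detL (b m)) r%:Z := witness_ord bQ.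
  have brec : beta_rec m a b by move=> n le_mn; apply: laurent_orbit_rec.
  have D1 : drsubmx (Q 0%N) \in unitmx by rewrite Q0dr unitmx1.
  have [Z1n Z2n Z3n] := (regularE m0 bP bQ Q0ul Q0ur bord brec D1).1 reg.
  have D0 : \det (drsubmx (c0 (b m))) != 0.
    by rewrite /c0 bQ (coefL_powL Q 0) -unitfE -unitmxE.
  have pn : p.@[@ppoint (r + s) K a P Q] != 0.
    rewrite (pE (a, P, Q)); have [g0 <-] := fg _ reg.
    by rewrite mulf_neq0 // witness_H.
  exists a, P, Q, b; split; [|exact: conj D0 Z1n|exact: Z2n|exact: Z3n|exact: pn].
  by split; [exact: bP|exact: bQ|split|exact: bord|exact: brec].
move=> alpha P Q beta [bP bQ [Q0ul Q0ur] bord brec] /(D_unit _ _ bQ) D1 Z1n Z2n Z3n pn.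
have reg : regular m (alpha, P, Q).
  apply: (regularE m0 bP bQ Q0ul Q0ur bord brec D1).2.
  by split; [exact: Z1n|exact: Z2n|exact: Z3n].
apply/(exact_ord_m4 m0 bP bQ Q0ul Q0ur bord brec D1 reg).
have [_ fE] := fg _ reg.
(* If [det (H 0)] vanished, so would the numerator [p]. *)
apply: contraNneq pn => H0; rewrite (pE (alpha, P, Q)) -fE.
by rewrite [\det _]H0 mul0r.
Qed.
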